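(* Let $F_2$ be the free group on two generators and let $\pi$ be a linear group. Then for any action of $\pi$ on $F_2$ by automorphisms, the semidirect product $F_2 \rtimes \pi$ (that is, any group $G$ that fits into a split extension $1 \to F_2 \to G \to \pi \to 1$) is linear. In particular, any group $G$ that fits into a group extension $1 \to F_2 \to G \to \mathbb{Z} \to 1$ is linear.
   Context: A group is called linear if it admits a faithful, finite-dimensional representation in $GL(m,k)$ for some $m$ and some field $k$ of characteristic zero. *)

(* Defs.v *)
From HB Require Import structures.
From mathcomp Require Import all_boot all_algebra.

Set Implicit Arguments.
Unset Strict Implicit.
Unset Printing Implicit Defensive.

Import GRing.Theory.
Local Open Scope group_scope.

(* Between groups, [UMagmaMorphism.type] is the library's type of group
   homomorphisms (it is what [isGroupMorphism.Build] constructs).             *)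
Notation "{ 'gmorphism' G '->' H }" := (UMagmaMorphism.type G%type H%type)
  (at level 0, G at level 98, H at level 99,
   format "{ 'gmorphism'  G  ->  H }") : type_scope.

Section GeneralLinearGroup.
Variables (k : fieldType) (m : nat).

Record GL := MkGL {GLmx : 'M[k]_m; GLmx_unit : GLmx \in unitmx}.

HB.instance Definition _ := [isSub for GLmx].
HB.instance Definition _ := [Choice of GL by <:].

Implicit Types A B C : GL.

Definition GL1 := MkGL (unitmx1 k m).

Fact GLmul_subproof A B : (GLmx A *m GLmx B)%R \in unitmx.
Proof. by rewrite unitmx_mul !GLmx_unit. Qed.
Definition GLmul A B := MkGL (GLmul_subproof A B).

Fact GLinv_subproof A : invmx (GLmx A) \in unitmx.
Proof. by rewrite unitmx_inv GLmx_unit. Qed.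
Definition GLinv A := MkGL (GLinv_subproof A).

Fact GLmulA : associative GLmul.
Proof. by move=> A B C; apply: val_inj; rewrite /= mulmxA. Qed.
Fact GLmul1g : left_id GL1 GLmul.
Proof. by move=> A; apply: val_inj; rewrite /= mul1mx. Qed.
Fact GLmulg1 : right_id GL1 GLmul.
Proof. by move=> A; apply: val_inj; rewrite /= mulmx1. Qed.
Fact GLmulVg : left_inverse GL1 GLinv GLmul.
Proof. by move=> A; apply: val_inj; rewrite /= mulVmx ?GLmx_unit. Qed.
Fact GLmulgV : right_inverse GL1 GLinv GLmul.
Proof. by move=> A; apply: val_inj; rewrite /= mulmxV ?GLmx_unit. Qed.

HB.instance Definition _ :=
  isGroup.Build GL GLmulA GLmul1g GLmulg1 GLmulVg GLmulgV.

End GeneralLinearGroup.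

Definition is_linear (G : groupType) : Prop :=
  exists (k : fieldType) (m : nat) (rho : {gmorphism G -> GL k m}),
    [pchar k]%R =i pred0 /\ injective rho.

(* The free group on S is the set of reduced words in the letters s, s^-1:
   (s, false) stands for s and (s, true) for s^-1.                            *)
Section FreeGroup.
Variable S : choiceType.
Implicit Types (l : S * bool) (u v w : seq (S * bool)).

Definition letter_inv l := (l.1, ~~ l.2).

Definition reduced w := sorted (fun l1 l2 => l2 != letter_inv l1) w.

Record free_group := Word {wordval : seq (S * bool); word_reduced : reduced wordval}.

HB.instance Definition _ := [isSub for wordval].
HB.instance Definition _ := [Choice of free_group by <:].

(* Reduced form of l :: w, for w reduced. *)
Definition wpush l w :=
  if w is l' :: w' then if l' == letter_inv l then w' else l :: w else [:: l].

(* Reduced form of u ++ v, for v reduced. *)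
Definition wmul u v := foldr wpush v u.

Definition winv w := rev (map letter_inv w).

Lemma letter_invK : involutive letter_inv.
Proof. by case=> s b; rewrite /letter_inv /= negbK. Qed.

Lemma reduced_tail l w : reduced (l :: w) -> reduced w.
Proof. exact: path_sorted. Qed.

Lemma wpush_reduced l w : reduced w -> reduced (wpush l w).
Proof.
case: w => [|l' w] //= w_red; case: eqP => [_|/eqP ne]; first exact: path_sorted w_red.
by rewrite /= ne.
Qed.

Lemma wpush_id l w : reduced (l :: w) -> wpush l w = l :: w.
Proof. by case: w => [|l' w] //= /andP[/negPf->]. Qed.

Lemma wpushK l w : reduced w -> wpush l (wpush (letter_inv l) w) = w.
Proof.
case: w => [|l' w] w_red /=; first by rewrite eqxx.
rewrite letter_invK; case: (l' =P l) w_red => [-> |_] w_red; last by rewrite /= eqxx.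
exact: wpush_id.
Qed.

Lemma wmul_reduced u v : reduced v -> reduced (wmul u v).
Proof. by move=> v_red; elim: u => //= l u; apply: wpush_reduced. Qed.

Lemma wmul_push l u w : reduced w -> wmul (wpush l u) w = wpush l (wmul u w).
Proof.
move=> w_red; case: u => [|l' u] //=; case: eqP => [->|_] //=.
by rewrite wpushK ?wmul_reduced.
Qed.

Lemma wmulA u v w : reduced w -> wmul u (wmul v w) = wmul (wmul u v) w.
Proof. by move=> w_red; elim: u => //= l u ->; rewrite wmul_push. Qed.

Lemma wmul0 w : reduced w -> wmul w [::] = w.
Proof.
elim: w => //= l w IHw lw_red.
by rewrite IHw ?wpush_id //; apply: reduced_tail lw_red.
Qed.

Lemma winv_reduced w : reduced w -> reduced (winv w).
Proof.
rewrite /reduced /winv rev_sorted sorted_map; apply: sub_sorted => l1 l2 /=.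
by rewrite letter_invK eq_sym.
Qed.

Lemma winvK : involutive winv.
Proof. by move=> w; rewrite /winv map_rev revK mapK //; apply: letter_invK. Qed.

Lemma wmulVw w : reduced w -> wmul (winv w) w = [::].
Proof.
elim: w => //= l w IHw lw_red.
rewrite /winv /= rev_cons /wmul foldr_rcons /= letter_invK eqxx.
exact/IHw/reduced_tail/lw_red.
Qed.

Lemma wmulwV w : reduced w -> wmul w (winv w) = [::].
Proof. by move=> w_red; rewrite -{1}(winvK w) wmulVw ?winv_reduced. Qed.

Implicit Types x y z : free_group.

Definition fg_one : free_group := @Word [::] isT.
Definition fg_mul x y := Word (wmul_reduced (wordval x) (word_reduced y)).
Definition fg_inv x := Word (winv_reduced (word_reduced x)).

Fact fg_mulA : associative fg_mul.
Proof. by move=> x y z; apply/val_inj/wmulA/word_reduced. Qed.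
Fact fg_mul1g : left_id fg_one fg_mul.
Proof. by move=> x; apply: val_inj. Qed.
Fact fg_mulg1 : right_id fg_one fg_mul.
Proof. by move=> x; apply/val_inj/wmul0/word_reduced. Qed.
Fact fg_mulVg : left_inverse fg_one fg_inv fg_mul.
Proof. by move=> x; apply/val_inj/wmulVw/word_reduced. Qed.
Fact fg_mulgV : right_inverse fg_one fg_inv fg_mul.
Proof. by move=> x; apply/val_inj/wmulwV/word_reduced. Qed.

HB.instance Definition _ :=
  isGroup.Build free_group fg_mulA fg_mul1g fg_mulg1 fg_mulVg fg_mulgV.

Definition fg_gen (s : S) : free_group := @Word [:: (s, false)] isT.

End FreeGroup.

Section FreeGroupUniversalProperty.
Variables (S : choiceType) (G : groupType) (f : S -> G).

Let leval (l : S * bool) : G := if l.2 then (f l.1)^-1 else f l.1.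
Let weval (w : seq (S * bool)) : G := \prod_(l <- w) leval l.

Let leval_inv l : leval (letter_inv l) = (leval l)^-1.
Proof. by case: l => s []; rewrite /leval /= ?invgK. Qed.

Let weval_push l w : weval (wpush l w) = leval l * weval w.
Proof.
rewrite /weval; case: w => [|l' w] /=; first by rewrite big_seq1 big_nil mulg1.
case: eqP => [->|_]; last by rewrite big_cons.
by rewrite big_cons leval_inv mulVKg.
Qed.

Let weval_mul u v : weval (wmul u v) = weval u * weval v.
Proof.
elim: u => [|l u IHu] /=; first by rewrite /weval big_nil mul1g.
by rewrite weval_push IHu [weval (l :: u)]big_cons mulgA.
Qed.

Theorem free_group_universal :
  exists phi : {gmorphism free_group S -> G},
    (forall s, phi (fg_gen s) = f s) /\
    forall psi : {gmorphism free_group S -> G},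
      (forall s, psi (fg_gen s) = f s) -> psi =1 phi.
Proof.
pose h (x : free_group S) := weval (wordval x).
have h1 : h 1 = 1 by rewrite /h /weval big_nil.
have hM : {morph h : x y / x * y} by move=> x y; apply: weval_mul.
pose hm := isUMagmaMorphism.Build _ _ h (h1, hM).
pose phi : {gmorphism free_group S -> G} := HB.pack h hm.
exists phi; split=> [s|psi psiE]; first by rewrite /phi /= /h /weval big_seq1.
case=> w w_red; rewrite /phi /= /h /=.
elim: w w_red => [|l w IHw] lw_red.
  rewrite /weval big_nil -(@gmulf1 _ _ psi); congr (psi _); exact: val_inj.
have w_red := reduced_tail lw_red.
pose x := @Word S [:: l] isT.
have -> : Word lw_red = x * Word w_red.
  by apply: val_inj; rewrite /= wpush_id.
rewrite gmulfM IHw /weval big_cons; congr (_ * _).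
rewrite {}/x /leval; case: l {lw_red IHw} => s [] /=; last first.
  by rewrite -psiE; congr (psi _); apply: val_inj.
by rewrite -psiE -gmulfV; congr (psi _); apply: val_inj.
Qed.

End FreeGroupUniversalProperty.

Definition F2 : groupType := free_group bool.

(* A left action of H on the group N by automorphisms: each [actby h] is an
   endomorphism of N, with inverse [actby h^-1]. *)
Record autaction (H N : groupType) := AutAction {
  actby :> H -> N -> N;
  actby1 : forall n, actby 1 n = n;
  actbyM : forall h1 h2 n, actby (h1 * h2) n = actby h1 (actby h2 n);
  actby_morph : forall h, {morph actby h : n1 n2 / n1 * n2}
}.

Record semidirect (N H : groupType) (phi : autaction H N) :=
  SemidirectPair {sd_fst : N; sd_snd : H}.

Section SemidirectProduct.
Variables (N H : groupType) (phi : autaction H N).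
Implicit Types x y z : semidirect phi.

Definition pair_of_semidirect x := (sd_fst x, sd_snd x).
Definition semidirect_of_pair (u : N * H) := SemidirectPair phi u.1 u.2.
Fact pair_of_semidirectK : cancel pair_of_semidirect semidirect_of_pair.
Proof. by case. Qed.

HB.instance Definition _ :=
  Choice.copy (semidirect phi) (can_type pair_of_semidirectK).

Definition sd_one := SemidirectPair phi 1 1.
Definition sd_mul x y :=
  SemidirectPair phi (sd_fst x * phi (sd_snd x) (sd_fst y)) (sd_snd x * sd_snd y).
Definition sd_inv x :=
  SemidirectPair phi (phi (sd_snd x)^-1 (sd_fst x)^-1) (sd_snd x)^-1.

Lemma actby_one h : phi h 1 = 1.
Proof. by apply: (@mulgI _ (phi h 1)); rewrite -actby_morph !mulg1. Qed.

Fact sd_mulA : associative sd_mul.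
Proof. by move=> x y z; rewrite /sd_mul /= actby_morph actbyM !mulgA. Qed.
Fact sd_mul1g : left_id sd_one sd_mul.
Proof. by case=> n h; rewrite /sd_mul /= actby1 !mul1g. Qed.
Fact sd_mulg1 : right_id sd_one sd_mul.
Proof. by case=> n h; rewrite /sd_mul /= actby_one !mulg1. Qed.
Fact sd_mulVg : left_inverse sd_one sd_inv sd_mul.
Proof. by case=> n h; rewrite /sd_mul /= -actby_morph !mulVg actby_one. Qed.
Fact sd_mulgV : right_inverse sd_one sd_inv sd_mul.
Proof. by case=> n h; rewrite /sd_mul /= -actbyM !mulgV actby1 mulgV. Qed.

HB.instance Definition _ :=
  isGroup.Build (semidirect phi) sd_mulA sd_mul1g sd_mulg1 sd_mulVg sd_mulgV.

End SemidirectProduct.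

(* 1 -> N -> G -> Q -> 1 is exact, with maps i and p. *)
Definition group_extension (N G Q : groupType)
    (i : {gmorphism N -> G}) (p : {gmorphism G -> Q}) : Prop :=
  [/\ injective i,
      forall g, p g = 1 <-> exists n, i n = g
    & forall q, exists g, p g = q].

Definition split_extension (N G Q : groupType)
    (i : {gmorphism N -> G}) (p : {gmorphism G -> Q}) : Prop :=
  group_extension i p /\ exists s : {gmorphism Q -> G}, cancel s p.

Definition Zgroup : groupType := Algebra.to_multiplicative int.

(* Main.v *)
Require Import Defs.
From mathcomp Require Import all_boot all_algebra.
From HB Require Import structures.
From mathcomp Require Import ring zify.
From Stdlib Require Import Classical.

Set Implicit Arguments.
Unset Strict Implicit.
Unset Printing Implicit Defensive.

Import GRing.Theory Num.Theory.

(** Let 1 -> F2 -> G -> P -> 1 be an extension with P linear over k.  The group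
G acts on F2 by conjugation, and an element acting trivially and dying in P is
a central element of F2, hence 1; so G embeds into Aut(F2) x P and it suffices
to represent, faithfully on Aut(F2), any group acting on F2.  All three claims
are instances of [extension_is_linear].

For this it is enough to have a faithful representation R of F2 over a field
K containing k whose conjugacy class is preserved by Aut(F2) up to exchanging
the two generators.  Indeed the linear span of the matrices (R x | R (swap x))
is then finite-dimensional, every automorphism h acts on it by sending the
matrix of x to that of h x, and h acts trivially only if it fixes every x
([induced_rep], [action_rep]).

R is the restriction of the Lawrence-Krammer representation of the braid group
B_4 to its normal free subgroup with basis a = x1 x3^-1, b = x2 a x2^-1, where
x1, x2, x3 are the standard generators.

Invariance.  Conjugation by x1, x2, x3 maps (a, b) to (a, b a^-1),
(b, b a^-1 b) and (a, a^-1 b).  These substitutions, together with the exchange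
of a and b, yield all elementary Nielsen moves ([similar2_inv],
[similar2_mul]), and by Nielsen's theorem ([nielsen]) these moves lead from
(a, b) to the image of (a, b) under any automorphism ([rep_twist]).

Faithfulness ([rep_faithful]).  The full twist of B_4 is central and acts by a
scalar, so up to powers of it each x in F2 is a positive braid word.  Following
Krammer and Hee, a positive word w is determined up to braid relations by the
image of the all-ones vector ([run_lk_ones_inj]): at u = 0 the matrices have
nonnegative entries, and the zero coordinates of the image tell which
generators divide w on the left ([supp_divides]), so that one can cancel a
common first letter and induct.  If R x = 1, the positive word of x is therefore
braid-equivalent to a power of the full twist.  Now B_4 also acts on F2, the
word of x by conjugation by x and the full twist trivially; hence x is central
in F2 and x = 1. *)

(** * Words in the positive braid monoid on four strands *)

Variant artin := s1 | s2 | s3.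

Definition artin_eqb (i j : artin) :=
  match i, j with s1, s1 | s2, s2 | s3, s3 => true | _, _ => false end.

Fact artin_eqP : Equality.axiom artin_eqb.
Proof. by case; case; constructor. Qed.

HB.instance Definition _ := hasDecEq.Build artin artin_eqP.

Definition braid_action (X : Type) (act : artin -> X -> X) :=
  [/\ forall x, act s1 (act s3 x) = act s3 (act s1 x),
      forall x, act s1 (act s2 (act s1 x)) = act s2 (act s1 (act s2 x))
    & forall x, act s2 (act s3 (act s2 x)) = act s3 (act s2 (act s3 x))].

Definition run X (act : artin -> X -> X) (w : seq artin) (x : X) := foldr act x w.

Lemma run_cat X (act : artin -> X -> X) u v x :
  run act (u ++ v) x = run act u (run act v x).
Proof. exact: foldr_cat. Qed.

(** Equality in the positive braid monoid, expressed through its actions: only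
two of them are used, on vectors and on F2, and a semantic definition makes
both transfers immediate. *)
Definition braid_equiv (v w : seq artin) :=
  forall X (act : artin -> X -> X), braid_action act -> run act v =1 run act w.

Definition head_moves (w : seq artin) : seq (seq artin) :=
  match w with
  | s1 :: s3 :: w' => [:: [:: s3, s1 & w']]
  | s3 :: s1 :: w' => [:: [:: s1, s3 & w']]
  | s1 :: s2 :: s1 :: w' => [:: [:: s2, s1, s2 & w']]
  | s2 :: s1 :: s2 :: w' => [:: [:: s1, s2, s1 & w']]
  | s2 :: s3 :: s2 :: w' => [:: [:: s3, s2, s3 & w']]
  | s3 :: s2 :: s3 :: w' => [:: [:: s2, s3, s2 & w']]
  | _ => [::]
  end.

Fixpoint moves (w : seq artin) : seq (seq artin) :=
  if w is i :: w' then head_moves w ++ map (cons i) (moves w') else [::].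

Lemma head_moves_equiv v w : v \in head_moves w -> braid_equiv w v.
Proof.
case: w => [|[] [|[] [|[] w]]] //=; rewrite ?inE // => /eqP-> X act [c13 b12 b23] x /=;
  by rewrite ?c13 ?b12 ?b23.
Qed.

Lemma moves_equiv v w : v \in moves w -> braid_equiv w v.
Proof.
elim: w v => // i w IHw v; rewrite mem_cat => /orP[/head_moves_equiv // |].
by case/mapP=> v' /IHw eq_wv' -> X act actP x /=; rewrite (eq_wv' X act actP).
Qed.

Definition explore (ws : seq (seq artin)) := undup (ws ++ flatten (map moves ws)).

(** Every word of this list is equivalent to w, which is all that the proofs
rely on; the number of rounds only has to suffice for the words inspected below. *)
Definition braid_class (w : seq artin) := iter 12 explore [:: w].

Lemma braid_class_equiv v w : v \in braid_class w -> braid_equiv w v.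
Proof.
rewrite /braid_class; elim: 12 v => [|n IHn] v; first by rewrite inE => /eqP->.
rewrite iterS mem_undup mem_cat => /orP[/IHn // |].
case/flatten_mapP=> z /IHn eq_wz /moves_equiv eq_zv X act actP x.
by rewrite (eq_wz X act actP) (eq_zv X act actP).
Qed.

Definition left_divides (v w : seq artin) := exists z, braid_equiv w (v ++ z).

(** The action on supports of nonnegative vectors of the Lawrence-Krammer
matrices at u = 0 (compare [lk_act]): a coordinate of the image vanishes exactly
when all the coordinates that enter it vanish.  The value true stands for a nonzero
coordinate. *)
Definition supp_act (j : artin) (b : seq bool) : seq bool :=
  if b is [:: b0; b1; b2; b3; b4; b5] then
    match j with
    | s1 => [:: false; b3; b4; b1 || b3; b2 || b4; b5]
    | s2 => [:: b0 || b1; b0; b2; false; b5; b4 || b5]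
    | s3 => [:: b0; b1 || b2; b1; b3 || b4; b3; false]
    end
  else [::].

Definition supp (w : seq artin) := run supp_act w (nseq 6 true).

(** One reduced word for each of the 24 permutations of four strands, that is,
for each left divisor of the half twist. *)
Definition simples : seq (seq artin) :=
  [:: [::]; [:: s1]; [:: s2]; [:: s3];
      [:: s1; s2]; [:: s1; s3]; [:: s2; s1]; [:: s2; s3]; [:: s3; s2];
      [:: s1; s2; s1]; [:: s1; s2; s3]; [:: s1; s3; s2]; [:: s2; s1; s3];
      [:: s2; s3; s2]; [:: s3; s2; s1];
      [:: s1; s2; s1; s3]; [:: s1; s2; s3; s2]; [:: s1; s3; s2; s1];
      [:: s2; s1; s3; s2]; [:: s2; s3; s2; s1];
      [:: s1; s2; s1; s3; s2]; [:: s1; s2; s3; s2; s1]; [:: s2; s1; s3; s2; s1];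
      [:: s1; s2; s1; s3; s2; s1]].

(** Each support that can occur is paired with a left divisor common to all the
words having that support.  For the support of a simple braid y the divisor is y;
the only other support that occurs is that of s2 s2 s1 s3 s2, where s2 is all
that can be guaranteed. *)
Definition states : seq (seq bool * seq artin) :=
  (supp [:: s2; s2; s1; s3; s2], [:: s2]) :: [seq (supp y, y) | y <- simples].

(** The conditional is there for the sake of evaluation: the braid class is
computed only for the pair of states with matching supports. *)
Definition state_step (j : artin) (st st' : seq bool * seq artin) :=
  if supp_act j st.1 == st'.1 then has (prefix st'.2) (braid_class (j :: st.2))
  else false.

Lemma states_closed j : all (fun st => has (state_step j st) states) states.
Proof. by case: j; vm_compute. Qed.

(** The position of the coordinate x_(j,j+1); multiplying by the j-th matrix
makes it divisible by u. *)
Definition root_index (j : artin) := match j with s1 => 0 | s2 => 3 | s3 => 5 end.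

Lemma states_divisor j :
  all (fun st => nth true st.1 (root_index j)
                 || has (prefix [:: j]) (braid_class st.2)) states.
Proof. by case: j; vm_compute. Qed.

Lemma left_divides_class v w z :
  has (prefix v) (braid_class w) -> left_divides v (w ++ z).
Proof.
case/hasP=> y /braid_class_equiv eq_wy /prefixP[y' def_y].
exists (y' ++ z) => X act actP x.
by rewrite catA -def_y !run_cat (eq_wy X act actP).
Qed.

(** Reading a word from right to left, the support evolves as a finite
automaton, and the divisor attached to the new state divides j times the
divisor attached to the previous one. *)
Lemma supp_state w :
  exists2 st, st \in states & supp w = st.1 /\ left_divides st.2 w.
Proof.
elim: w => [|j w [st st_in [eq_w [z eq_wz]]]].
  by exists (supp [::], [::]) => //; split=> //; exists [::].
have /hasP[st' st'_in] := allP (states_closed j) st st_in.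
rewrite /state_step; case: eqP => // eq_st' div_st'.
exists st' => //; split; first by rewrite -eq_st' -eq_w.
have [y eq_y] := left_divides_class z div_st'.
exists y => X act actP x; rewrite -(eq_y X act actP) /=.
by rewrite (eq_wz X act actP).
Qed.

Lemma supp_divides j w :
  ~~ nth true (supp w) (root_index j) -> left_divides [:: j] w.
Proof.
have [st st_in [-> [z eq_wz]]] := supp_state w => j_supp.
have /orP[/idPn//|/(left_divides_class z)[y eq_y]] := allP (states_divisor j) st st_in.
by exists y => X act actP x; rewrite (eq_wz X act actP) (eq_y X act actP).
Qed.

(** * The Lawrence-Krammer matrices *)

Local Open Scope ring_scope.

Definition vec6 (R : Type) : Type := R * R * R * R * R * R.

Definition map6 (R S : Type) (f : R -> S) (x : vec6 R) : vec6 S :=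
  let: (x0, x1, x2, x3, x4, x5) := x in (f x0, f x1, f x2, f x3, f x4, f x5).

Definition seq6 (R : Type) (x : vec6 R) : seq R :=
  let: (x0, x1, x2, x3, x4, x5) := x in [:: x0; x1; x2; x3; x4; x5].

(** Coordinates are indexed by the pairs (1,2), (1,3), (1,4), (2,3), (2,4), (3,4).
The parameters of the Lawrence-Krammer representation are specialised to q = 1/2
and t = 8 u, and the matrices are multiplied by 2: the coefficients become
integral, and the braid relations, being homogeneous, still hold. *)
Section LawrenceKrammer.
Variables (R : comNzRingType) (u : R).

Definition lk_act (j : artin) (x : vec6 R) : vec6 R :=
  let: (x0, x1, x2, x3, x4, x5) := x in
  match j with
  | s1 => (u * (4 * x0 - 4 * x1 - 4 * x2), 2 * x3, 2 * x4, x1 + x3, x2 + x4, 2 * x5)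
  | s2 => (x0 + 2 * x1, x0, 2 * x2, u * (- 2 * x1 + 2 * x2 + 4 * x3 - 4 * x4),
           2 * x5, x4 + x5)
  | s3 => (2 * x0, x1 + 2 * x2, x1, x3 + 2 * x4, x3, u * (- x2 - 2 * x4 + 4 * x5))
  end.

Lemma lk_braid : braid_action lk_act.
Proof.
by split=> -[[[[[x0 x1] x2] x3] x4] x5] /=;
  do 5?[congr (_, _)]; ring.
Qed.

(** Prefixed by j, this is a word for the half twist; such a word exists for each
generator, and provides the inverse of its matrix up to a scalar. *)
Definition half_tail (j : artin) : seq artin :=
  match j with
  | s1 => [:: s2; s3; s1; s2; s1]
  | s2 => [:: s1; s2; s3; s2; s1]
  | s3 => [:: s2; s1; s3; s2; s3]
  end.

Definition half_twist : seq artin := s1 :: half_tail s1.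

(** The half twist reverses the order of the strands, so it permutes the
coordinates up to scalars; squaring it is then immediate. *)
Lemma lk_half j x0 x1 x2 x3 x4 x5 :
  run lk_act (j :: half_tail j) (x0, x1, x2, x3, x4, x5) =
  (128 * u * x5, 64 * u * x4, 32 * u * x2, 32 * u * x3, 16 * u * x1, 8 * u * x0).
Proof. by case: j => /=; do 5?[congr (_, _)]; ring. Qed.

Definition twist_tail (j : artin) := half_tail j ++ half_twist.

Definition twist_scalar : R := 1024 * u ^+ 2.

Lemma lk_twist j x : run lk_act (j :: twist_tail j) x = map6 ( *%R twist_scalar) x.
Proof.
case: x => [[[[[x0 x1] x2] x3] x4] x5].
rewrite /twist_tail -cat_cons run_cat /half_twist !lk_half /twist_scalar /map6.
by do 5?[congr (_, _)]; ring.
Qed.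

Definition lk_rows (j : artin) : seq (seq R) :=
  match j with
  | s1 => [:: [:: 4 * u; - 4 * u; - 4 * u; 0; 0; 0]; [:: 0; 0; 0; 2; 0; 0];
              [:: 0; 0; 0; 0; 2; 0]; [:: 0; 1; 0; 1; 0; 0];
              [:: 0; 0; 1; 0; 1; 0]; [:: 0; 0; 0; 0; 0; 2]]
  | s2 => [:: [:: 1; 2; 0; 0; 0; 0]; [:: 1; 0; 0; 0; 0; 0];
              [:: 0; 0; 2; 0; 0; 0]; [:: 0; - 2 * u; 2 * u; 4 * u; - 4 * u; 0];
              [:: 0; 0; 0; 0; 0; 2]; [:: 0; 0; 0; 0; 1; 1]]
  | s3 => [:: [:: 2; 0; 0; 0; 0; 0]; [:: 0; 1; 2; 0; 0; 0];
              [:: 0; 1; 0; 0; 0; 0]; [:: 0; 0; 0; 1; 2; 0];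
              [:: 0; 0; 0; 1; 0; 0]; [:: 0; 0; - u; 0; - 2 * u; 4 * u]]
  end.

Definition lk_mx (j : artin) : 'M[R]_6 :=
  \matrix_(i, k) nth 0 (nth [::] (lk_rows j) i) k.

Definition col6 (x : vec6 R) : 'cV[R]_6 := \col_i nth 0 (seq6 x) i.

Lemma lk_mxE j x : lk_mx j *m col6 x = col6 (lk_act j x).
Proof.
case: x => [[[[[x0 x1] x2] x3] x4] x5].
apply/matrixP=> i k; rewrite !mxE !big_ord_recl big_ord0 !mxE /=.
by case: j; case: i => [[|[|[|[|[|[|//]]]]]] lti] /=; ring.
Qed.

Lemma col6_surj (v : 'cV[R]_6) : exists x, v = col6 x.
Proof.
pose c i := v (inord i) 0; exists (c 0%N, c 1%N, c 2%N, c 3%N, c 4%N, c 5%N).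
apply/matrixP=> i k; rewrite mxE [k]ord1 -[in LHS](inord_val i).
by case: i => [[|[|[|[|[|[|//]]]]]] lti].
Qed.

Lemma col6_inj : injective col6.
Proof.
move=> [[[[[x0 x1] x2] x3] x4] x5] [[[[[y0 y1] y2] y3] y4] y5] eq_xy.
have coord k : (k < 6)%N -> nth 0 [:: x0; x1; x2; x3; x4; x5] k
                         = nth 0 [:: y0; y1; y2; y3; y4; y5] k.
  by move=> ltk; have /matrixP/(_ (Ordinal ltk) 0) := eq_xy; rewrite !mxE.
by move: (coord 0 isT) (coord 1 isT) (coord 2 isT) (coord 3 isT) (coord 4 isT) (coord 5 isT)
  => /= -> -> -> -> -> ->.
Qed.

Lemma mx6_col_ext (A B : 'M[R]_6) :
  (forall x, A *m col6 x = B *m col6 x) -> A = B.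
Proof.
move=> eqAB; apply/matrixP=> i k.
have [x def_x] := col6_surj (delta_mx k 0).
have := eqAB x; rewrite -def_x => /matrixP/(_ i 0).
by rewrite -!colE !mxE.
Qed.

Definition lk_word (w : seq artin) : 'M[R]_6 := run (fun j => mulmx (lk_mx j)) w 1%:M.

Lemma lk_wordE w x : lk_word w *m col6 x = col6 (run lk_act w x).
Proof.
by elim: w => [|j w IHw] /=; rewrite ?mul1mx // -mulmxA [_ *m col6 x]IHw lk_mxE.
Qed.

Lemma lk_word_cat v w : lk_word (v ++ w) = lk_word v *m lk_word w.
Proof.
by rewrite /lk_word run_cat; elim: v => [|j v IHv] /=; rewrite ?mul1mx // IHv mulmxA.
Qed.

Lemma lk_mx_braid :
  [/\ lk_mx s1 *m lk_mx s3 = lk_mx s3 *m lk_mx s1,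
      lk_mx s1 *m lk_mx s2 *m lk_mx s1 = lk_mx s2 *m lk_mx s1 *m lk_mx s2
    & lk_mx s2 *m lk_mx s3 *m lk_mx s2 = lk_mx s3 *m lk_mx s2 *m lk_mx s3].
Proof.
have [c13 b12 b23] := lk_braid.
by split; apply: mx6_col_ext => x; rewrite -!mulmxA !lk_mxE ?c13 ?b12 ?b23.
Qed.

Lemma lk_mx_twist j : lk_mx j *m lk_word (twist_tail j) = twist_scalar%:M.
Proof.
apply: mx6_col_ext => x; rewrite -mulmxA lk_wordE lk_mxE [lk_act _ _](lk_twist j x).
rewrite mul_scalar_mx; apply/matrixP=> i k; rewrite !mxE.
case: x => [[[[[x0 x1] x2] x3] x4] x5].
by case: i => [[|[|[|[|[|[|//]]]]]] lti].
Qed.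

End LawrenceKrammer.

Lemma lk_act_map (R S : comNzRingType) (f : {rmorphism R -> S}) (u : R) w x :
  run (lk_act (f u)) w (map6 f x) = map6 f (run (lk_act u) w x).
Proof.
elim: w => //= j w ->; case: (run _ w x) => [[[[[x0 x1] x2] x3] x4] x5].
by case: j => /=; rewrite ?(rmorphD, rmorphN, rmorphB, rmorphM, rmorph_nat, rmorph1).
Qed.

Definition ones (R : nzRingType) : vec6 R := (1, 1, 1, 1, 1, 1).

(** Positivity is what makes supports computable: sums of nonnegative integers
do not cancel. *)
Lemma lk_supp w :
  let x := run (lk_act (0 : int)) w (ones int) in
  all (>= 0) (seq6 x) /\ [seq c != 0 | c <- seq6 x] = supp w.
Proof.
elim: w => //= j w; rewrite -/(supp w).
case: (run _ w _) => [[[[[x0 x1] x2] x3] x4] x5] /= [/and5P[p0 p1 p2 p3 /and3P[p4 p5 _]] <-].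
have two c : (2 * c != 0 :> int) = (c != 0) by rewrite mulf_eq0.
have two_ge0 (c : int) : 0 <= c -> 0 <= 2 * c by move=> c0; rewrite mulr_ge0.
have add0 (c d : int) : 0 <= c -> 0 <= d -> (c + d != 0) = (c != 0) || (d != 0).
  by move=> c0 d0; rewrite paddr_eq0 // negb_and.
have supp_ge0 := (mul0r, two, add0, addr_ge0, two_ge0, p0, p1, p2, p3, p4, p5).
by case: j => /=; rewrite !supp_ge0.
Qed.

Local Close Scope ring_scope.

(** * The monoid orbit of the all-ones vector is free *)

Local Open Scope ring_scope.

Section Faithful.
Variables (K : fieldType) (phi : {rmorphism {poly int} -> K}).
Hypothesis phi_inj : injective phi.

Let u := phi 'X.

Lemma twist_scalar_neq0 : twist_scalar u != 0.
Proof.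
rewrite /twist_scalar -(rmorph_nat phi) -rmorphXn -rmorphM -(rmorph0 phi) (inj_eq phi_inj).
by rewrite mulf_neq0 ?expf_neq0 ?polyX_eq0 // -polyC_natr polyC_eq0.
Qed.

Lemma lk_mx_unit j : lk_mx u j \in unitmx.
Proof.
have := lk_mx_twist u j; set c := twist_scalar u => def_c.
have : lk_mx u j *m (c^-1 *: lk_word u (twist_tail j)) = 1%:M.
  by rewrite -scalemxAr def_c scale_scalar_mx mulVf ?twist_scalar_neq0.
by case/mulmx1_unit.
Qed.

Lemma lk_act_inj j : injective (lk_act u j).
Proof.
move=> x y eq_xy; apply: col6_inj.
by rewrite -[col6 x](mulKmx (lk_mx_unit j)) lk_mxE eq_xy -lk_mxE mulKmx ?lk_mx_unit.
Qed.

Lemma run_lk_ones_supp v w :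
  run (lk_act u) v (ones K) = run (lk_act u) w (ones K) -> supp v = supp w.
Proof.
have -> : ones K = map6 phi (ones {poly int}) by rewrite /= rmorph1.
rewrite !lk_act_map => eq_phi.
have {eq_phi} : run (lk_act 'X) v (ones {poly int}) = run (lk_act 'X) w (ones {poly int}).
  move: eq_phi; case: (run _ v _) => [[[[[x0 x1] x2] x3] x4] x5].
  case: (run _ w _) => [[[[[y0 y1] y2] y3] y4] y5] [].
  by do 6!move/phi_inj->.
(* reduction modulo u *)
pose ev0 : {rmorphism {poly int} -> int} := horner_eval 0.
have ev0X : ev0 'X = 0 by rewrite /ev0 /= horner_evalE hornerX.
have ev0_ones : map6 ev0 (ones {poly int}) = ones int by rewrite /= !rmorph1.
move/(congr1 (map6 ev0)); rewrite -!(lk_act_map ev0) ev0X ev0_ones.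
by move=> eq_vw; rewrite -(lk_supp v).2 -(lk_supp w).2 eq_vw.
Qed.

Lemma supp_cons j w : ~~ nth true (supp (j :: w)) (root_index j).
Proof.
rewrite /= -/(supp w) -(lk_supp w).2.
by case: (run _ w _) => [[[[[x0 x1] x2] x3] x4] x5]; case: j.
Qed.

(** If both sides agree, they have the same support, so the first letter of v
also divides w; the matrix of that letter is invertible and can be cancelled. *)
Lemma run_lk_ones_inj v w :
  run (lk_act u) v (ones K) = run (lk_act u) w (ones K) -> braid_equiv v w.
Proof.
elim: v w => [|j v IHv] w eq_vw; have eq_supp := run_lk_ones_supp eq_vw.
  by case: w eq_supp {eq_vw} => // j w eq_supp; have := supp_cons j w; rewrite -eq_supp; case: (j).
have := supp_cons j v; rewrite eq_supp => /supp_divides[z eq_wz].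
have /IHv eq_vz : run (lk_act u) v (ones K) = run (lk_act u) z (ones K).
  by apply: (@lk_act_inj j); rewrite -[RHS](eq_wz _ _ (lk_braid u)).
by move=> X act actP x; rewrite (eq_wz X act actP) /= (eq_vz X act actP).
Qed.

End Faithful.

Local Close Scope ring_scope.

(** * Morphisms out of the free group, and the braid action on it *)

Local Open Scope group_scope.

Definition gen_a : F2 := fg_gen false.
Definition gen_b : F2 := fg_gen true.

Definition F2_letter (l : bool * bool) : F2 := Word (isT : reduced [:: l]).

Lemma F2_cons l w (lw_red : reduced (l :: w)) :
  Word lw_red = F2_letter l * Word (reduced_tail lw_red).
Proof. by apply: val_inj; rewrite /= wpush_id. Qed.

Section Substitution.
Variables (G : groupType) (f : bool -> G).

Definition letter_val (l : bool * bool) : G := if l.2 then (f l.1)^-1 else f l.1.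

Definition subst (x : F2) : G := foldr (fun l y => letter_val l * y) 1 (wordval x).

Lemma morph_subst (h : {gmorphism F2 -> G}) :
  (forall s, h (fg_gen s) = f s) -> h =1 subst.
Proof.
move=> hf [w w_red]; rewrite /subst /=.
elim: w w_red => [|l w IHw] lw_red.
  by rewrite -(@gmulf1 _ _ h); congr (h _); apply: val_inj.
rewrite F2_cons gmulfM IHw /=; congr (_ * _).
case: l {lw_red} => s [] /=; rewrite /letter_val -hf /=; last by congr (h _); apply: val_inj.
by rewrite -gmulfV; congr (h _); apply: val_inj.
Qed.

Lemma subst_morph : (subst 1 = 1) * {morph subst : x y / x * y}.
Proof.
have [h [hf _]] := free_group_universal f.
by split=> [|x y]; rewrite // -!(morph_subst hf) gmulfM.
Qed.

HB.instance Definition _ := isUMagmaMorphism.Build F2 G subst subst_morph.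

Lemma subst_gen s : subst (fg_gen s) = f s.
Proof. by rewrite /subst /= mulg1. Qed.

End Substitution.

(** Stated for bare functions, so as to apply to compositions and conjugations
without packaging them as morphisms. *)
Lemma F2_morph_ext (G : groupType) (h k : F2 -> G) :
    {morph h : x y / x * y} -> {morph k : x y / x * y} ->
  h gen_a = k gen_a -> h gen_b = k gen_b -> h =1 k.
Proof.
move=> hM kM eq_a eq_b.
have h1 : h 1 = 1 by apply: (@mulgI _ (h 1)); rewrite -hM !mulg1.
have k1 : k 1 = 1 by apply: (@mulgI _ (k 1)); rewrite -kM !mulg1.
pose h' : {gmorphism F2 -> G} := HB.pack h (isUMagmaMorphism.Build _ _ h (h1, hM)).
pose k' : {gmorphism F2 -> G} := HB.pack k (isUMagmaMorphism.Build _ _ k (k1, kM)).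
move=> x; rewrite -[h x]/(h' x) -[k x]/(k' x).
by rewrite !(@morph_subst _ (fun s => h (fg_gen s))) //; case.
Qed.

Lemma size_wmul (u v : seq (bool * bool)) : (size (wmul u v) <= size u + size v)%N.
Proof.
elim: u => //= l u IHu; case: (wmul u v) IHu => [|l' z] //= IHu.
by case: ifP => _; [rewrite ltnW // ltnW | rewrite /= ltnS].
Qed.

(** If w is not empty, let y be the generator other than that of the first
letter of w: then y w is reduced and begins with y, whereas w y is either
shorter or begins like w. *)
Lemma F2_centerless (x : F2) : (forall y : F2, x * y = y * x) -> x = 1.
Proof.
case: x => -[|l w] lw_red x_central; first exact: val_inj.
have := x_central (fg_gen (~~ l.1)) => /(congr1 (@wordval _)) /=.
rewrite -/(wmul w _).
have -> : l == letter_inv (~~ l.1, false) = false.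
  by case: l {lw_red x_central} => [[] []].
have := size_wmul w [:: (~~ l.1, false)].
case: (wmul w _) => [|l' z] /= size_z; first by case.
case: ifP => _ => [eq_z | [eq_l]].
  by move: size_z; rewrite eq_z /= addn1 ltnNge leqnSn.
by exfalso; case: l eq_l {lw_red x_central size_z} => [[] []].
Qed.

(** Conjugation by the braid generators on the normal free subgroup with basis
a = x1 x3^-1, b = x2 a x2^-1 of B_4; see [braid_conj1], [braid_conj2] and
[braid_conj3]. *)
Definition braid_img (j : artin) (s : bool) : F2 :=
  match j, s with
  | s1, false => gen_a | s1, true => gen_b * gen_a^-1
  | s2, false => gen_b | s2, true => gen_b * gen_a^-1 * gen_b
  | s3, false => gen_a | s3, true => gen_a^-1 * gen_b
  end.

Definition F2_act (j : artin) : F2 -> F2 := subst (braid_img j).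

Lemma run_F2_actM w : {morph run F2_act w : x y / x * y}.
Proof.
elim: w => // j w IHw x y; rewrite -[LHS]/(F2_act j (run F2_act w (x * y))) IHw.
exact: gmulfM.
Qed.

Lemma F2_act_braid : braid_action F2_act.
Proof.
split.
- by apply: (F2_morph_ext (run_F2_actM [:: s1; s3]) (run_F2_actM [:: s3; s1])); apply: val_inj.
- by apply: (F2_morph_ext (run_F2_actM [:: s1; s2; s1]) (run_F2_actM [:: s2; s1; s2]));
    apply: val_inj.
- by apply: (F2_morph_ext (run_F2_actM [:: s2; s3; s2]) (run_F2_actM [:: s3; s2; s3]));
    apply: val_inj.
Qed.

Definition full_twist := s1 :: twist_tail s1.

Lemma F2_act_twist x : run F2_act full_twist x = x.
Proof.
by move: x; apply: (@F2_morph_ext _ _ id) => //; [apply: run_F2_actM | |]; apply: val_inj.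
Qed.

(** Positive words for a, a^-1, b, b^-1 up to powers of the full twist: x_j^-1 is
replaced by the positive word completing x_j to a full twist. *)
Definition letter_word (l : bool * bool) : seq artin :=
  match l with
  | (false, false) => s1 :: twist_tail s3
  | (false, true) => s3 :: twist_tail s1
  | (true, false) => [:: s2, s1 & twist_tail s3 ++ twist_tail s2]
  | (true, true) => [:: s2, s3 & twist_tail s1 ++ twist_tail s2]
  end.

Lemma F2_act_letter l x : run F2_act (letter_word l) x = x ^ (F2_letter l)^-1.
Proof.
move: x; apply: F2_morph_ext; [exact: run_F2_actM | by move=> x y; apply: conjMg | |];
  by case: l => [[] []]; apply: val_inj.
Qed.

Local Close Scope group_scope.

(** * Conjugacy of pairs in a group with braid relations *)

Local Open Scope group_scope.

Lemma braid_conj (G : groupType) (y z : G) :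
  y * z * y = z * y * z -> y * z^-1 * y^-1 = z^-1 * y^-1 * z.
Proof.
move=> yzy; have eq_zy : y * z * y^-1 = z^-1 * y * z.
  by apply: (mulgI z); apply: (mulIg y); rewrite !mulgA mulgVK mulgV mul1g -yzy.
by have := congr1 (fun g => g^-1) eq_zy; rewrite !invgM !invgK !mulgA.
Qed.

Section BraidConjugation.
Variables (G : groupType) (x1 x2 x3 : G).
Hypotheses (c13 : x1 * x3 = x3 * x1) (b12 : x1 * x2 * x1 = x2 * x1 * x2)
  (b23 : x2 * x3 * x2 = x3 * x2 * x3).

Let a := x1 * x3^-1.
Let b := x2 * a * x2^-1.

Let c13V : x3^-1 * x1 = x1 * x3^-1.
Proof. by apply: (mulgI x3); rewrite !mulgA mulgV mul1g -c13 mulgK. Qed.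

Let b12V : x1^-1 * x2 * x1 = x2 * x1 * x2^-1.
Proof. by apply: (mulgI x1); apply: (mulIg x2); rewrite !mulgA mulgV mul1g mulgVK. Qed.

Let b23V : x3^-1 * x2^-1 * x3^-1 = x2^-1 * x3^-1 * x2^-1.
Proof. by have := congr1 (fun g => g^-1) b23; rewrite !invgM !mulgA. Qed.

(** The three substitutions performed on (a, b) by conjugation. *)
Lemma braid_conj1 : (a ^ x1^-1 = a) * (b ^ x1^-1 = b * a^-1).
Proof.
split; rewrite conjgE invgK /b /a; first by rewrite -c13V !mulgA mulgK c13V.
rewrite invgM invgK !mulgA; congr (_ * _); rewrite b12.
by rewrite -!mulgA; do 2!congr (_ * _); rewrite !mulgA; apply: braid_conj.
Qed.

Lemma braid_conj3 : (a ^ x3^-1 = a) * (b ^ x3^-1 = a^-1 * b).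
Proof.
split; rewrite conjgE invgK /b /a; first by rewrite !mulgA -c13 mulgK.
rewrite invgM invgK -!mulgA; congr (_ * _).
by rewrite [x3^-1 * (_ * _)]mulgA b23V !mulgA b12V.
Qed.

Lemma braid_conj2 : (a ^ x2^-1 = b) * (b ^ x2^-1 = b * a^-1 * b).
Proof.
split; rewrite conjgE invgK /b /a !mulgA //.
rewrite invgM invgK.
have -> : x2 * x1 * x3^-1 * x2^-1 * (x3 * x1^-1) * x2 * x1 * x3^-1 * x2^-1
        = x2 * x1 * (x3^-1 * x2^-1 * x3) * (x1^-1 * x2 * x1) * x3^-1 * x2^-1.
  by rewrite !mulgA.
rewrite b12V -(braid_conj b23) !mulgA mulgVK.
have -> : x2 * x1 * x2 * x3^-1 * x1 * x2^-1 * x3^-1 * x2^-1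
        = x2 * x1 * x2 * (x3^-1 * x1) * x2^-1 * x3^-1 * x2^-1 by rewrite !mulgA.
rewrite c13V.
have -> : x2 * x1 * x2 * (x1 * x3^-1) * x2^-1 * x3^-1 * x2^-1
        = x2 * (x1 * x2 * x1) * (x3^-1 * x2^-1 * x3^-1) * x2^-1 by rewrite !mulgA.
by rewrite b12 b23V !mulgA mulgK.
Qed.

Definition similar (A B : G) := exists g, A = a ^ g /\ B = b ^ g.

Lemma similar_conj A B g : similar A B -> similar (A ^ g) (B ^ g).
Proof. by case=> h [-> ->]; exists (h * g); rewrite !conjgM. Qed.

(** Multiplying the conjugator g on the left by x1, x2, x3 or their inverses
turns the substitutions above into moves on pairs.  The move of [similar_rot]
has order four, so its inverse is its third iterate. *)
Lemma similar_mulVr A B : similar A B -> similar A (B * A^-1).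
Proof.
case=> g [-> ->]; exists (x1^-1 * g).
by rewrite !conjgM !braid_conj1 (conjMg b) conjVg.
Qed.

Lemma similar_mulVl A B : similar A B -> similar A (A^-1 * B).
Proof.
case=> g [-> ->]; exists (x3^-1 * g).
by rewrite !conjgM !braid_conj3 (conjMg a^-1) conjVg.
Qed.

Lemma similar_mulr A B : similar A B -> similar A (B * A).
Proof.
case=> g [-> ->]; exists (x1 * g); rewrite !conjgM -(conjMg b).
have [a1 b1] := braid_conj1.
have a1' : a ^ x1 = a by rewrite -{1}a1 conjgKV.
rewrite a1'; split=> //; congr (_ ^ g).
by apply: (conjg_inj x1^-1); rewrite conjgK (conjMg b) a1 b1 mulgVK.
Qed.

Lemma similar_rot A B : similar A B -> similar B A^-1.
Proof.
case=> g [-> ->].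
(* b a^-1 b is multiplied by b^-1 on both sides *)
have /similar_mulVl/similar_mulVr : similar (b ^ g) ((b * a^-1 * b) ^ g).
  by exists (x2^-1 * g); rewrite !conjgM !braid_conj2.
by rewrite (conjMg (b * a^-1)) (conjMg b) conjVg -(mulgA (b ^ g)) mulKg mulgK.
Qed.

Lemma similar_rot3 A B : similar A B -> similar B^-1 A.
Proof. by move/similar_rot/similar_rot/similar_rot; rewrite invgK. Qed.

(** The moves above have determinant 1 on the abelianisation; allowing the
exchange of the two entries covers the moves of determinant -1 as well. *)
Definition similar2 A B := similar A B \/ similar B A.

Lemma similar2_swap A B : similar2 A B -> similar2 B A.
Proof. by case; [right | left]. Qed.

Lemma similar2_inv A B : similar2 A B -> similar2 A^-1 B.
Proof. by case=> [/similar_rot | /similar_rot3]; [right | left]. Qed.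

Lemma similar2_mul A B : similar2 A B -> similar2 (A * B) B.
Proof.
case=> [/similar_rot/similar_mulVl/similar_rot3 | /similar_mulr]; last by right.
by rewrite invgM !invgK; left.
Qed.

Lemma similar2_conj A B g : similar2 A B -> similar2 (A ^ g) (B ^ g).
Proof. by case=> /(similar_conj g); [left | right]. Qed.

End BraidConjugation.

Local Close Scope group_scope.

(** * A faithful six-dimensional representation of the free group *)

Local Open Scope group_scope.
Local Open Scope ring_scope.

Section FaithfulRep.
Variables (K : fieldType) (phi : {rmorphism {poly int} -> K}).
Hypothesis phi_inj : injective phi.

Let u := phi 'X.
Let c : K := twist_scalar u.

Definition lk_gl (j : artin) : GL K 6 := MkGL (lk_mx_unit phi_inj j).

Lemma lk_gl_braid :
  [/\ lk_gl s1 * lk_gl s3 = lk_gl s3 * lk_gl s1,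
      lk_gl s1 * lk_gl s2 * lk_gl s1 = lk_gl s2 * lk_gl s1 * lk_gl s2
    & lk_gl s2 * lk_gl s3 * lk_gl s2 = lk_gl s3 * lk_gl s2 * lk_gl s3]%g.
Proof. by have [c13 b12 b23] := lk_mx_braid u; split; apply: val_inj. Qed.

Definition rep_img (s : bool) : GL K 6 :=
  let a := (lk_gl s1 * (lk_gl s3)^-1)%g in
  if s then (lk_gl s2 * a * (lk_gl s2)^-1)%g else a.

Definition rep : F2 -> GL K 6 := subst rep_img.

Lemma lk_word_twist_tail j : lk_word u (twist_tail j) = c *: invmx (lk_mx u j).
Proof.
rewrite -[LHS](mulKmx (lk_mx_unit phi_inj j)) lk_mx_twist.
by rewrite mul_mx_scalar.
Qed.

Lemma lk_word_cons j w : lk_word u (j :: w) = lk_mx u j *m lk_word u w.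
Proof. by []. Qed.

Lemma lk_letter_word l :
  exists m, lk_word u (letter_word l) = c ^+ m *: GLmx (letter_val rep_img l).
Proof.
rewrite /letter_val; case: l => [[] []]; rewrite /letter_word; cbn [fst snd];
  [exists 2%N | exists 2%N | exists 1%N | exists 1%N]; rewrite ?expr1 ?expr2;
  rewrite 1?[LHS]lk_word_cons;
    [rewrite lk_word_cons lk_word_cat | rewrite lk_word_cons lk_word_cat | |];
  rewrite !lk_word_twist_tail
    -?scalemxAr -?scalemxAl -?scalemxAr ?scalerA /rep_img ?invgM ?invgK //=; congr (_ *: _);
  by rewrite !mulmxA.
Qed.

Definition braid_word (w : seq (bool * bool)) : seq artin := flatten (map letter_word w).

Lemma braid_word_cons l w : braid_word (l :: w) = letter_word l ++ braid_word w.
Proof. by []. Qed.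

(** Evaluating the positive word of x instead of x itself only introduces a
power of the scalar by which the full twist acts. *)
Lemma lk_braid_word x :
  exists m, lk_word u (braid_word (wordval x)) = c ^+ m *: GLmx (rep x).
Proof.
case: x => w w_red; rewrite /rep /subst /=.
elim: w {w_red} => [|l w [m IHw]]; first by exists 0%N; rewrite expr0 scale1r.
have [n eq_n] := lk_letter_word l; exists (n + m)%N.
rewrite braid_word_cons lk_word_cat IHw eq_n.
by rewrite -scalemxAl -scalemxAr scalerA exprD.
Qed.

Lemma subst_fg_gen x : subst (@fg_gen bool) x = x.
Proof. by move: x; apply: (@F2_morph_ext _ _ id) => //; [apply: gmulfM | |]; apply: val_inj. Qed.

Lemma run_F2_act_braid_word (x y : F2) :
  run F2_act (braid_word (wordval x)) y = (y ^ x^-1)%g.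
Proof.
rewrite -{2}[x]subst_fg_gen; case: x => w w_red; rewrite /subst /=.
elim: w {w_red} => [|l w IHw]; first by rewrite invg1 conjg1.
rewrite braid_word_cons run_cat IHw F2_act_letter.
rewrite invgM conjgM; congr (_ ^ _^-1)%g.
by case: l => s []; apply: val_inj.
Qed.

Definition twist_power m := flatten (nseq m full_twist).

Lemma twist_powerS m : twist_power m.+1 = full_twist ++ twist_power m.
Proof. by []. Qed.

Lemma lk_twist_power m : lk_word u (twist_power m) = (c ^+ m)%:M.
Proof.
elim: m => [|m IHm] //.
rewrite twist_powerS lk_word_cat IHm.
by rewrite /full_twist lk_word_cons lk_mx_twist exprS -scalar_mxM.
Qed.

Lemma F2_act_twist_power m x : run F2_act (twist_power m) x = x.
Proof.
elim: m => [|m IHm] //.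
by rewrite twist_powerS run_cat IHm F2_act_twist.
Qed.

Lemma rep_faithful x : rep x = 1%g -> x = 1%g.
Proof.
move=> rep_x1; have [m] := lk_braid_word x; rewrite rep_x1 /= scalemx1 -lk_twist_power.
move=> eq_word; have /run_lk_ones_inj eq_braid :
    run (lk_act u) (braid_word (wordval x)) (ones K) = run (lk_act u) (twist_power m) (ones K).
  by apply: col6_inj; rewrite -!lk_wordE eq_word.
apply: F2_centerless => y; apply: (@mulIg _ x^-1%g).
have := run_F2_act_braid_word x y; rewrite (eq_braid phi_inj _ _ F2_act_braid).
by rewrite F2_act_twist_power conjgE invgK mulgK -mulgA.
Qed.

Lemma rep_inj : injective rep.
Proof.
move=> x y eq_xy; apply: (@mulIg _ y^-1%g); rewrite mulgV; apply: rep_faithful.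
have -> : rep (x * y^-1)%g = (rep x * (rep y)^-1)%g by rewrite /rep gmulfM gmulfV.
by rewrite eq_xy mulgV.
Qed.

End FaithfulRep.

Local Close Scope ring_scope.
Local Close Scope group_scope.

(** * Cancellation lengths in the free group *)

Local Open Scope group_scope.
Local Open Scope nat_scope.

Notation letter := (bool * bool)%type.

Definition len (x : F2) := size (wordval x).

Fixpoint lcp (s t : seq letter) : nat :=
  if s is l :: s' then if t is m :: t' then if l == m then (lcp s' t').+1 else 0 else 0
  else 0.

(** The Gromov product based at 1 in the Cayley tree. *)
Definition gromov (x y : F2) := lcp (wordval x) (wordval y).

(** The tree is 0-hyperbolic. *)
Lemma lcp_ultra r s t : minn (lcp s r) (lcp r t) <= lcp s t.
Proof.
elim: r s t => [|l r IHr] [|m s] [|n t] //=; rewrite ?minn0 ?min0n //.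
have [->|_] := eqVneq m l; last by rewrite min0n.
by have [_|_] := eqVneq l n; rewrite ?minn0 // minnSS ltnS.
Qed.

Lemma lcpC s t : lcp s t = lcp t s.
Proof. by elim: s t => [|l s IHs] [|m t] //=; rewrite eq_sym IHs. Qed.

Lemma lcpP k s t : k <= lcp s t -> take k s = take k t.
Proof.
elim: s t k => [|l s IHs] [|m t] [|k] //=.
by case: eqP => [->|//]; rewrite ltnS => /IHs->.
Qed.

Lemma lcp_refl s : lcp s s = size s.
Proof. by elim: s => //= l s ->; rewrite eqxx. Qed.

Lemma wmul_cat (u v : seq letter) : reduced (u ++ v) -> wmul u v = u ++ v.
Proof.
elim: u => //= l u IHu uv_red.
by rewrite IHu ?wpush_id //; apply: reduced_tail uv_red.
Qed.

Lemma size_wmul_winv (s t : seq letter) : reduced s -> reduced t ->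
  size (wmul (winv s) t) + 2 * lcp s t = size s + size t.
Proof.
elim: s t => [|l s IHs] [|m t] s_red t_red.
- by [].
- by rewrite /= addn0.
- by rewrite wmul0 ?winv_reduced // /winv size_rev size_map /= muln0.
have [eq_lm|ne_lm] := eqVneq l m.
  rewrite /winv /= rev_cons /wmul foldr_rcons /= letter_invK eq_lm eqxx /=.
  have := IHs t (reduced_tail s_red) (reduced_tail t_red).
  by rewrite /winv /wmul; move: (size (foldr _ _ _)) => k; lia.
rewrite wmul_cat ?size_cat /= ?(negPf ne_lm) ?muln0 ?addn0 /winv ?size_rev ?size_map //.
have := winv_reduced s_red; rewrite /winv /= rev_cons.
case: (rev _) => [|n z]; rewrite /reduced /= ?letter_invK ?(eq_sym m) ?ne_lm //.
by rewrite cat_path last_rcons /= letter_invK eq_sym ne_lm => ->.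
Qed.

Lemma len_mulV (x y : F2) : len (x^-1 * y)%g + 2 * gromov x y = len x + len y.
Proof. exact: size_wmul_winv (word_reduced x) (word_reduced y). Qed.

Lemma len_inv (x : F2) : len x^-1%g = len x.
Proof. by rewrite /len /= /winv size_rev size_map. Qed.

Lemma len_mul (x y : F2) : len (x * y)%g + 2 * gromov x^-1%g y = len x + len y.
Proof. by rewrite -{1}[x]invgK len_mulV len_inv. Qed.

(** If half of x or more were cancelled in x x, the middle letters of x would be
mutually inverse: a letter equal to its inverse in odd length, two adjacent
inverse letters in even length. *)
Lemma len_sqr (x : F2) : x <> 1%g -> 2 * gromov x^-1%g x < len x.
Proof.
case: x => w w_red; rewrite /gromov /len /= => x_neq1; rewrite ltnNge; apply/negP=> le_w.
have half_lt n k : 0 < n -> n <= 2 * k -> n.-1./2 < k by lia.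
have w_gt0 : 0 < size w by case: w w_red x_neq1 {le_w} => // r []; apply: val_inj.
(* position of the last letter of the first half, or of the middle letter *)
pose h := (size w).-1./2; pose l0 : letter := (false, false).
have lt_h : h < lcp (winv w) w by apply: half_lt.
have lt_hw : h < size w by rewrite /h; apply: half_lt; rewrite // mul2n -addnn leq_addr.
have := congr1 (fun s => nth l0 s h) (lcpP lt_h); rewrite !nth_take //.
rewrite /winv nth_rev ?size_map // (nth_map l0); last by rewrite ltn_subrL w_gt0.
set k := size w - h.+1 => eq_kh.
(* k is the position opposite to h *)
have [k_h|k_h] : k = h \/ k = h.+1.
  by move: w_gt0; rewrite /k /h; clear; case: (size w) => //= n _; lia.
  by move: eq_kh; rewrite k_h; case: (nth _ _ _) => ? [].
have /(sortedP l0)/(_ h) := w_red; rewrite -k_h -eq_kh letter_invK eqxx.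
by move=> bad; suff /bad : k < size w by []; rewrite /k ltn_subrL w_gt0.
Qed.

Local Close Scope nat_scope.
Local Close Scope group_scope.

(** * Nielsen-reduced pairs *)

Local Open Scope group_scope.
Local Open Scope nat_scope.

Lemma gromov_ultra x y z : minn (gromov x y) (gromov y z) <= gromov x z.
Proof. exact: lcp_ultra. Qed.

Lemma gromovC x y : gromov x y = gromov y x.
Proof. exact: lcpC. Qed.

Section Pairs.
Variable f : bool -> F2.
Notation lv := (letter_val f).

Lemma letter_val_inv l : lv (letter_inv l) = (lv l)^-1%g.
Proof. by case: l => s [] /=; rewrite /letter_val /= ?invgK. Qed.

Definition cancel_len (l m : letter) := gromov (lv l)^-1%g (lv m).

(** By [len_mul], this means that no product of two letters is shorter than one
of its factors, and that no letter is completely cancelled between two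
neighbours. *)
Definition nielsen_reduced :=
  (forall l m, m != letter_inv l ->
     2 * cancel_len l m <= len (lv l) /\ 2 * cancel_len l m <= len (lv m)) /\
  (forall l m n, m != letter_inv l -> n != letter_inv m ->
     cancel_len l m + cancel_len m n < len (lv m)).

(** In a product of letters, each factor leaves at least one uncancelled symbol.
The induction keeps track of how much of the first factor l survives at the
start of the product: by hyperbolicity, the next factor on the left cancels
against the product no more than it does against l. *)
Lemma nielsen_reduced_len (y : F2) : nielsen_reduced -> len y <= len (subst f y).
Proof.
case: y => w w_red [half triple]; rewrite {1}/len /subst /=.
pose g w := foldr (fun l y => lv l * y)%g 1%g w : F2; rewrite -/(g w).
pose next (l : letter) w := if w is m :: _ then cancel_len l m else 0.
have lv_gt0 l : 0 < len (lv l).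
  have ne_ll : l != letter_inv l by case: l => [[] []].
  have := triple l l l ne_ll ne_ll; exact: leq_ltn_trans.
suff grow l w' : reduced (l :: w') ->
    size w' + len (lv l) - next l w' <= len (g (l :: w')) /\
    len (lv l) - next l w' <= gromov (g (l :: w')) (lv l).
  case: w w_red => // l w lw_red; have [le_g _] := grow l w lw_red.
  apply: leq_trans le_g; suff: next l w < len (lv l) by rewrite /=; lia.
  by case: w lw_red => // m w /= /andP[/half[le_l _] _]; have := lv_gt0 l; lia.
elim: w' l {w w_red} => [|m w' IHw] l lw_red.
  by rewrite /= mulg1 /gromov lcp_refl subn0.
have /= /andP[ne_lm w_red] := lw_red; have [IH1 IH2] := IHw m w_red.
have [le_l le_m] := half _ _ ne_lm.
have lt_m : cancel_len l m + next m w' < len (lv m).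
  case: w' w_red {IHw IH1 IH2 lw_red} => [|n w'] /=; last by case/andP=> /(triple _ _ _ ne_lm).
  by move=> _; have := lv_gt0 m; lia.
set gm := g (m :: w') in IH1 IH2 *.
have le_gromov : gromov (lv l)^-1%g gm <= cancel_len l m.
  have := gromov_ultra (lv l)^-1%g gm (lv m); rewrite -/(cancel_len l m) geq_min.
  by case/orP=> // le_gm; lia.
rewrite -[(lv m * g w')%g]/gm.
have len_lm := len_mul (lv l) gm.
have := len_mulV (lv l) (lv l * gm)%g; rewrite mulKg gromovC => len_gm.
have lt_next : next m w' <= len (lv m) by apply: leq_trans (ltnW lt_m); apply: leq_addl.
clear -IH1 le_l lt_m le_gromov len_lm len_gm lt_next.
move: (len (lv l * gm)) (gromov (lv l)^-1 gm) (gromov (lv l * gm) (lv l)) (len gm) (size w')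
  (next m w') (cancel_len l m) (len (lv m)) (len (lv l))
  IH1 le_l lt_m le_gromov len_lm len_gm lt_next; lia.
Qed.

End Pairs.

Local Close Scope nat_scope.
Local Close Scope group_scope.

(** * Nielsen moves reach every generating pair *)

Local Open Scope group_scope.
Local Open Scope nat_scope.

(** Quantifying over subgroups makes the stability under Nielsen moves and
conjugations a matter of checking the two generators. *)
Definition generating (u v : F2) := forall S : F2 -> Prop,
  S 1%g -> (forall x y, S x -> S y -> S (x * y)%g) -> (forall x, S x -> S x^-1%g) ->
  S u -> S v -> forall x, S x.

Lemma generating_sub u v u' v' :
  (forall S : F2 -> Prop, (forall x y, S x -> S y -> S (x * y)%g) ->
     (forall x, S x -> S x^-1%g) -> S u' -> S v' -> S u /\ S v) ->
  generating u v -> generating u' v'.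
Proof.
move=> sub gen S S1 SM SV Su' Sv'; have [Su Sv] := sub S SM SV Su' Sv'.
exact: gen S S1 SM SV Su Sv.
Qed.

Lemma generating_conj u v g : generating u v -> generating (u ^ g)%g (v ^ g)%g.
Proof.
move=> gen S S1 SM SV Su Sv x; rewrite -(conjgKV g x).
by apply: (gen (fun y => S (y ^ g)%g)) => // [|y z Sy Sz|y Sy];
  rewrite ?conj1g ?conjMg ?conjVg; auto.
Qed.

(** F2 is not abelian, so it is not generated by a single element. *)
Lemma generating_neq1 u v : generating u v -> v <> 1%g.
Proof.
move=> gen v1.
have comm_u x : (u * x = x * u)%g.
  apply: (gen (fun y => u * y = y * u)%g) => //; rewrite ?v1 ?mulg1 ?mul1g //.
    by move=> y z uy uz; rewrite mulgA uy -mulgA uz mulgA.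
  by move=> y uy; apply: (mulgI y); rewrite mulgA -uy mulgK mulVKg.
suff : (gen_a * gen_b = gen_b * gen_a)%g by move/(congr1 (@wordval _)).
apply: (gen (fun y => y * gen_b = gen_b * y)%g) => //; rewrite ?v1 ?mulg1 ?mul1g //.
  by move=> y z yb zb; rewrite -mulgA zb mulgA yb mulgA.
by move=> y yb; apply: (mulgI y); rewrite mulVKg mulgA yb mulgK.
Qed.

(** The predicate Q stands for membership in an orbit under Nielsen moves and
simultaneous conjugations.  Having conjugations among the moves allows the total
length alone to serve as the induction measure: the critical pairs, in which a
letter is cancelled completely between two neighbours, are shortened by a
conjugation. *)
Section Nielsen.
Variable Q : F2 -> F2 -> Prop.
Hypotheses (Q_swap : forall u v, Q u v -> Q v u)
  (Q_inv : forall u v, Q u v -> Q u^-1%g v)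
  (Q_mul : forall u v, Q u v -> Q (u * v)%g v)
  (Q_conj : forall u v g, Q u v -> Q (u ^ g)%g (v ^ g)%g)
  (Q_gen : Q gen_a gen_b).

Definition pair_of (u v : F2) (s : bool) := if s then v else u.

Notation lv u v := (letter_val (pair_of u v)).

Lemma generating_letters u v l m : l.1 != m.1 ->
  generating u v -> generating (lv u v l) (lv u v m).
Proof.
have invV (S : F2 -> Prop) (x : F2) : (forall x, S x -> S x^-1%g) -> S x^-1%g -> S x.
  by move=> SV /SV; rewrite invgK.
move=> ne_lm; apply: generating_sub => S SM SV; move: l m ne_lm => [[] []] [[] []] //= _ Sl Sm;
  split=> //; exact: invV.
Qed.

Lemma Q_of_letters u v l m : l.1 != m.1 -> Q (lv u v l) (lv u v m) -> Q u v.
Proof.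
have QV x y : Q x^-1%g y -> Q x y by move/Q_inv; rewrite invgK.
have QVr x y : Q x y^-1%g -> Q x y by move/Q_swap/QV/Q_swap.
by move: l m => [[] []] [[] []] //= _; rewrite /letter_val /=; auto.
Qed.

Lemma Q_mulV u v : Q (u * v)%g v -> Q u v.
Proof.
move=> /Q_swap/Q_inv/Q_swap/Q_mul/Q_swap/Q_inv/Q_swap.
by rewrite mulgK invgK.
Qed.

(** Each of a and b is a value of a reduced word in u and v; as it has length 1,
that word is a single letter. *)
Lemma nielsen_reduced_Q u v :
  generating u v -> nielsen_reduced (pair_of u v) -> Q u v.
Proof.
move=> gen nred; set f := pair_of u v in nred.
have subst_surj x : exists y, x = subst f y.
  move: x; apply: gen.
  - by exists 1%g; rewrite gmulf1.
  - by move=> x y [x' ->] [y' ->]; exists (x' * y')%g; rewrite gmulfM.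
  - by move=> x [x' ->]; exists x'^-1%g; rewrite gmulfV.
  - by exists gen_a; rewrite subst_gen.
  - by exists gen_b; rewrite subst_gen.
have gen_letter s : exists l, fg_gen s = letter_val f l.
  have [y def_s] := subst_surj (fg_gen s).
  have := nielsen_reduced_len y nred; rewrite -def_s /len {1}/fg_gen /=.
  case: y def_s => -[|l [|m w]] w_red //= def_s _.
  by exists l; rewrite def_s /subst /= mulg1.
have [l def_a] := gen_letter false; have [m def_b] := gen_letter true.
move: Q_gen; rewrite /gen_a /gen_b def_a def_b; apply: Q_of_letters.
apply/eqP=> eq_lm; suff [] : gen_a = gen_b \/ gen_a^-1%g = gen_b.
- by move/(congr1 (@wordval _)).
- by move/(congr1 (@wordval _)).
rewrite /gen_a /gen_b def_a def_b.
by move: l m eq_lm {def_a def_b} => [s []] [t []] /= ->; rewrite /letter_val /= ?invgK; auto.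
Qed.

Lemma nielsen_shorten u v l m : l.1 != m.1 -> generating u v ->
    (forall u' v', generating u' v' -> len u' + len v' < len u + len v -> Q u' v') ->
  len (lv u v l * lv u v m)%g < len (lv u v l) -> Q u v.
Proof.
move=> ne_lm gen IH lt_len; apply: (Q_of_letters ne_lm); apply: Q_mulV; apply: IH.
  apply: generating_sub (generating_letters ne_lm gen) => S SM SV Sxy Sy; split=> //.
  by rewrite -(mulgK (lv u v m) (lv u v l)); auto.
have -> : len u + len v = len (lv u v l) + len (lv u v m).
  by move: l m ne_lm {lt_len} => [[] []] [[] []] //= _; rewrite /letter_val /= ?len_inv // addnC.
by rewrite ltn_add2r.
Qed.

Lemma F2_split k (x : F2) : exists y z : F2,
  [/\ x = (y * z)%g, wordval y = take k (wordval x) & wordval z = drop k (wordval x)].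
Proof.
case: x => w w_red /=.
have y_red : reduced (take k w) by apply: take_sorted.
have z_red : reduced (drop k w) by apply: drop_sorted.
exists (Word y_red), (Word z_red); split=> //; apply: val_inj => /=.
by rewrite wmul_cat cat_take_drop.
Qed.

(** Under these hypotheses x = r z p and y = p^-1 r^-1 without cancellation, with
r and p of length k; conjugating the pair (x y, y) by r gives (z, r^-1 p^-1). *)
Lemma two_sided_cancel x y k : len y = k.*2 -> k.*2 <= len x ->
    gromov x^-1%g y = k -> gromov y^-1%g x = k ->
  exists r, len ((x * y) ^ r)%g + len (y ^ r)%g <= len x.
Proof.
move=> len_y len_x xy yx.
have [r [t [def_x r_word t_word]]] := F2_split k x.
have [z [p [def_t z_word p_word]]] := F2_split (len x - k.*2) t.
have [y1 [y2 [def_y y1_word y2_word]]] := F2_split k y.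
have size_r : len r = k by rewrite /len r_word size_takel //; rewrite -/(len x); lia.
have size_z : len z = len x - k.*2.
  by rewrite /len z_word size_takel // t_word size_drop -/(len x); lia.
have size_p : len p = k.
  by rewrite /len p_word size_drop t_word size_drop -/(len x); lia.
have winv_take (w : seq letter) : k <= size w -> take k (winv w) = winv (drop (size w - k) w).
  by rewrite /winv take_rev size_map map_drop.
have y1E : y1 = p^-1%g.
  apply: val_inj; rewrite [LHS]y1_word -[RHS]/(winv (wordval p)) p_word t_word drop_drop.
  rewrite -(lcpP (eq_leq (esym xy))) winv_take -/(len x); last by lia.
  by congr (winv (drop _ _)); lia.
have y2E : y2 = r^-1%g.
  rewrite -[y2]invgK; congr (_^-1)%g; apply: val_inj.
  rewrite -[LHS]/(winv (wordval y2)) [RHS]r_word y2_word -(lcpP (eq_leq (esym yx))).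
  by rewrite [RHS]winv_take -/(len y) len_y ?leq_addr -?addnn ?addnK ?leq_addr.
exists r; rewrite def_x def_t def_y y1E y2E.
have -> : ((r * (z * p) * (p^-1 * r^-1)) ^ r)%g = z.
  by rewrite conjgE !mulgA !mulgK mulVg mul1g mulgVK.
have -> : ((p^-1 * r^-1) ^ r)%g = (r^-1 * p^-1)%g by rewrite conjgE mulgVK.
rewrite -def_t -def_x.
have : len (r^-1 * p^-1)%g <= len r + len p.
  by rewrite -(len_inv r) -(len_inv p); apply: size_wmul.
lia.
Qed.

Lemma nielsen_conj_shorten u v l m : l.1 != m.1 -> generating u v ->
    (forall u' v', generating u' v' -> len u' + len v' < len u + len v -> Q u' v') ->
    let x := lv u v l in let y := lv u v m in
    2 * gromov x^-1%g y = len y -> 2 * gromov y^-1%g x = len y -> len y <= len x ->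
  Q u v.
Proof.
move=> ne_lm gen IH x y xy yx le_yx; have gen_xy := generating_letters ne_lm gen.
have y_gt0 : 0 < len y.
  rewrite lt0n; apply/eqP=> /size0nil y0.
  by apply: (generating_neq1 gen_xy); apply: val_inj; rewrite /= -/y y0.
have [] := @two_sided_cancel x y (gromov x^-1%g y); try lia.
move=> r short; apply: (Q_of_letters ne_lm); apply: Q_mulV.
rewrite -(conjgK r (_ * _)%g) -[X in Q _ X](conjgK r); apply: Q_conj; apply: IH.
  apply: generating_conj; apply: generating_sub gen_xy => S SM SV Sxy Sy; split=> //.
  by rewrite -(mulgK (lv u v m) (lv u v l)); auto.
have -> : len u + len v = len x + len y.
  by rewrite /x /y; move: l m ne_lm {x y xy yx le_yx gen_xy y_gt0 short} => [[] []] [[] []] //= _;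
    rewrite /letter_val /= ?len_inv // addnC.
by rewrite -/x -/y; lia.
Qed.

Lemma letter_inv_fst (l m : letter) : m != letter_inv l -> l.1 = m.1 -> l = m.
Proof. by move: l m => [[] []] [[] []]. Qed.

(** A generating pair is either reduced, or some product of two letters is
shorter than a factor, or some letter y is cancelled by exactly one half on each
side, by letters l and n.  In the last case l and n come from the other generator;
if they are inverse to each other then y and y^-1 have half of y in common, which
[len_sqr] forbids, so they are equal and a conjugation shortens the pair. *)
Lemma nielsen_step u v : generating u v ->
    (forall u' v', generating u' v' -> len u' + len v' < len u + len v -> Q u' v') ->
  Q u v.
Proof.
move=> gen IH; set f := pair_of u v; pose lf := letter_val f.
have lf_inv l : lf (letter_inv l) = (lf l)^-1%g by exact: letter_val_inv.
have [nred|] := boolP [forall l, forall m, (m != letter_inv l) ==>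
    (len (lf l) <= len (lf l * lf m)%g)]; last first.
  case/forallPn=> l /forallPn[m]; rewrite negb_imply -ltnNge => /andP[ne_lm short].
  apply: (nielsen_shorten _ gen IH short); apply/eqP=> /(letter_inv_fst ne_lm) eq_lm.
  have [lm1|/eqP/len_sqr] := eqVneq (lf m) 1%g.
    by move: short; rewrite eq_lm -/lf lm1 mulg1 ltnn.
  by have := len_mul (lf m) (lf m); move: short; rewrite eq_lm; lia.
have half l m : m != letter_inv l ->
    2 * gromov (lf l)^-1%g (lf m) <= len (lf l) /\ 2 * gromov (lf l)^-1%g (lf m) <= len (lf m).
  move=> ne_lm; have := len_mul (lf l) (lf m).
  have /forallP/(_ m)/implyP/(_ ne_lm) := forallP nred l.
  have ne_ml : letter_inv l != letter_inv (letter_inv m).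
    by rewrite letter_invK eq_sym.
  have /forallP/(_ (letter_inv l))/implyP/(_ ne_ml) := forallP nred (letter_inv m).
  rewrite !lf_inv -invgM !len_inv; move: (len (lf l * lf m)%g) (gromov _ _) => p q; lia.
have lf_neq1 l : lf l <> 1%g.
  have ne : (~~ l.1, false).1 != l.1 by case: (l.1).
  exact: generating_neq1 (generating_letters ne gen).
have sqr_lt l := len_sqr (lf_neq1 l).
have [triple|] := boolP [forall l, forall m, forall n,
    (m != letter_inv l) ==> (n != letter_inv m) ==>
    (gromov (lf l)^-1%g (lf m) + gromov (lf m)^-1%g (lf n) < len (lf m))].
  apply: nielsen_reduced_Q gen _; split=> [|l m n ne_lm ne_mn]; first exact: half.
  by have /forallP/(_ m)/forallP/(_ n) := forallP triple l; rewrite ne_lm ne_mn.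
case/forallPn=> l /forallPn[m /forallPn[n]].
rewrite !negb_imply -leqNgt => /and3P[ne_lm ne_mn long].
have [half_l half_m] := half _ _ ne_lm; have [half_m' half_n] := half _ _ ne_mn.
have ne1_lm : l.1 != m.1.
  apply/eqP=> /(letter_inv_fst ne_lm) eq_lm.
  by move: (sqr_lt m) long half_m half_m'; rewrite eq_lm; lia.
have ne1_mn : m.1 != n.1.
  apply/eqP=> /(letter_inv_fst ne_mn) eq_mn.
  by move: (sqr_lt m) long half_m half_m'; rewrite -eq_mn; lia.
(* only two letters come from the generator other than that of m *)
have [eq_nl|eq_nl] : n = l \/ n = letter_inv l.
  by move: l m n ne1_lm ne1_mn {ne_lm ne_mn long half_l half_m half_m' half_n}
    => [[] []] [[] []] [[] []] //= _ _; auto.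
  rewrite eq_nl in long half_m' half_n.
  by apply: (nielsen_conj_shorten ne1_lm gen IH); rewrite -/f -/lf; lia.
(* y and y^-1 both share half of their length with the inverse of l *)
move: (sqr_lt m) long half_m half_m'; rewrite eq_nl lf_inv.
have := gromov_ultra (lf m) (lf l)^-1%g (lf m)^-1%g.
rewrite (gromovC (lf m) (lf l)^-1%g) (gromovC (lf l)^-1%g (lf m)^-1%g) (gromovC (lf m) (lf m)^-1%g).
lia.
Qed.

Theorem nielsen u v : generating u v -> Q u v.
Proof.
have [n] := ubnP (len u + len v); elim: n u v => // n IHn u v lt_n gen.
by apply: nielsen_step => // u' v' gen' lt'; apply: IHn gen'; lia.
Qed.

End Nielsen.

Local Close Scope nat_scope.
Local Close Scope group_scope.

(** * Representations from actions that preserve linear relations *)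

Local Open Scope ring_scope.

Lemma free_spanning (K : fieldType) (V : vectType K) (X : Type) (r : X -> V) :
  exists ys : seq X, free (map r ys) /\ forall x, r x \in <<map r ys>>%VS.
Proof.
suff extend n ys : (\dim {:V} - size ys <= n)%N -> free (map r ys) ->
    exists ys' : seq X, free (map r ys') /\ forall x, r x \in <<map r ys'>>%VS.
  by apply: (extend _ [::] (leqnn _)); rewrite nil_free.
elim: n ys => [|n IHn] ys le_n ys_free;
  have [spans|/not_all_ex_not[x /negP x_notin]] := classic (forall x, r x \in <<map r ys>>%VS);
  try by exists ys.
- suff : (size (map r (x :: ys)) <= \dim {:V})%N.
    by rewrite /= size_map; move: le_n; rewrite leqn0 subn_eq0 leqNgt => /negPf->.
  have xys_free : free (map r (x :: ys)) by rewrite /= free_cons x_notin.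
  by move: (xys_free); rewrite /free => /eqP <-; apply/dimvS/subvf.
- apply: (IHn (x :: ys)); last by rewrite /= free_cons x_notin.
  by rewrite /= subnS -subn1 leq_subLR add1n.
Qed.

(** The group acts on the span of the vectors r x, because each element
preserves the linear relations among them.  In a basis consisting of vectors r y
this action is given by the matrices M below, which reverse products, whence the
inverse in the definition of the representation. *)
Section InducedRep.
Variables (K : fieldType) (V : vectType K) (X : Type) (G : groupType).
Variables (act : G -> X -> X) (r : X -> V).
Hypotheses (act1 : forall x, act 1%g x = x)
  (actM : forall g h x, act (g * h)%g x = act g (act h x))
  (act_rel : forall g n (c : 'I_n -> K) (y : 'I_n -> X) x,
     r x = \sum_i c i *: r (y i) -> r (act g x) = \sum_i c i *: r (act g (y i))).

Lemma induced_rep : exists d (rho : {gmorphism G -> GL K d}),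
  forall g, rho g = 1%g -> forall x, r (act g x) = r x.
Proof.
have [ys [ys_free ys_span]] := free_spanning r.
pose d := size ys; pose y : 'I_d -> X := tnth (in_tuple ys).
pose b : d.-tuple V := map_tuple r (in_tuple ys).
have bE (i : 'I_d) : b`_i = r (y i).
  by rewrite -tnth_nth tnth_map.
have b_free : free b by [].
have b_span x : r x = \sum_i coord b i (r x) *: r (y i).
  by rewrite [LHS](coord_span (ys_span x : r x \in <<b>>%VS)); apply: eq_bigr => i _; rewrite bE.
pose M g : 'M[K]_d := \matrix_(i, j) coord b j (r (act g (y i))).
have M1 : M 1%g = 1%:M.
  by apply/matrixP=> i j; rewrite !mxE act1 -bE coord_free // eq_sym.
have MM g h : M (g * h)%g = M h *m M g.
  apply/matrixP=> i k; rewrite !mxE actM (act_rel g (b_span (act h (y i)))).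
  by rewrite linear_sum; apply: eq_bigr => j _; rewrite linearZ !mxE.
have M_unit g : M g^-1%g \in unitmx.
  have : M g^-1%g *m M g = 1%:M by rewrite -MM mulgV.
  by case/mulmx1_unit.
pose rho0 g : GL K d := MkGL (M_unit g).
have rho0M : (rho0 1 = 1)%g * {morph rho0 : g h / (g * h)%g}.
  by split=> [|g h]; apply: val_inj => /=; rewrite ?invg1 // invgM MM.
pose rho : {gmorphism G -> GL K d} :=
  HB.pack rho0 (isUMagmaMorphism.Build _ _ rho0 rho0M).
exists d, rho => g /(congr1 (@GLmx _ _)) /= Mg1.
have fix_y i : r (act g^-1%g (y i)) = r (y i).
  rewrite [LHS]b_span (bigD1 i) //= big1 ?addr0 => [|j ne_ji].
    by have /matrixP/(_ i i) := Mg1; rewrite !mxE eqxx => ->; rewrite scale1r.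
  by have /matrixP/(_ i j) := Mg1; rewrite !mxE eq_sym (negPf ne_ji) => ->; rewrite scale0r.
move=> x; have := act_rel g^-1%g (b_span (act g x)).
rewrite -actM mulVg act1 => ->; rewrite [LHS]b_span.
by apply: eq_bigr => i _; rewrite fix_y.
Qed.

End InducedRep.

Local Close Scope ring_scope.

(** * Linearity of extensions by the free group *)

Local Open Scope group_scope.
Local Open Scope ring_scope.

(** The field k(u) receives both the representation of P, through the constants,
and the Lawrence-Krammer matrices, through the polynomials in u over int. *)
Section BaseChange.
Variables (k : fieldType) (k_char0 : [pchar k]%R =i pred0).

Definition ratfrac : fieldType := {fraction {poly k}}.

Definition constants : {rmorphism k -> ratfrac} := @tofrac _ \o @polyC k.

Definition int_poly_frac : {rmorphism {poly int} -> ratfrac} :=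
  @tofrac {poly k} \o map_poly (intr : int -> k).

Lemma tofrac_inj (R : idomainType) : injective (@tofrac R).
Proof. by move=> x y /eqP; rewrite tofrac_eq => /eqP. Qed.

Lemma natr_char0_eq0 n : (n%:R == 0 :> k) = (n == 0)%N.
Proof. by rewrite (pcharf0P _).1. Qed.

Lemma intr_char0_inj : injective (intr : int -> k).
Proof.
move=> m n /eqP; rewrite -subr_eq0 -mulrzBr => eq0; apply/eqP; rewrite -subr_eq0.
move: eq0; case: (m - n) => j; first by rewrite -pmulrn natr_char0_eq0.
by rewrite NegzE mulrNz oppr_eq0 -pmulrn natr_char0_eq0.
Qed.

Lemma int_poly_frac_inj : injective int_poly_frac.
Proof. by move=> p q /tofrac_inj; apply: map_inj_poly; [apply: intr_char0_inj|]. Qed.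

Lemma ratfrac_char0 : [pchar ratfrac] =i pred0.
Proof.
apply/pcharf0P => n.
by rewrite -(rmorph_nat constants) fmorph_eq0 natr_char0_eq0.
Qed.

End BaseChange.

Section Twisted.
Variables (K : fieldType) (phi : {rmorphism {poly int} -> K}).
Hypothesis phi_inj : injective phi.
Notation rep := (rep phi_inj).

Definition swap_gens : F2 -> F2 := subst (fun s => fg_gen (~~ s)).

Lemma generating_gens : generating gen_a gen_b.
Proof.
move=> S S1 SM SV Sa Sb x; rewrite -[x]subst_fg_gen; case: x => w w_red; rewrite /subst /=.
elim: w {w_red} => //= -[s b] w Sw; apply: SM => //.
by rewrite /letter_val; case: s b => [] [] /=; auto.
Qed.

Lemma generating_image (h : F2 -> F2) : {morph h : x y / (x * y)%g} ->
  (forall y, exists x, h x = y) -> generating (h gen_a) (h gen_b).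
Proof.
move=> hM h_surj S S1 SM SV Sa Sb y; have [x <-] := h_surj y.
have h1 : h 1%g = 1%g by apply: (@mulgI _ (h 1%g)); rewrite -hM !mulg1.
have hV z : h z^-1%g = (h z)^-1%g by apply: (mulgI (h z)); rewrite -hM !mulgV.
by apply: (generating_gens (S := fun z => S (h z))) => //= [|z t|z];
  rewrite ?h1 ?hM ?hV; auto.
Qed.

(** Nielsen's theorem applied to the predicate on pairs (u, v) saying that
(rep u, rep v) is conjugate to the images of the two generators, in one order or
the other. *)
Lemma rep_twist (h : F2 -> F2) : {morph h : x y / (x * y)%g} ->
    (forall y, exists x, h x = y) ->
  exists t, (forall x, rep (h x) = rep x ^ t)%g \/
            (forall x, rep (h x) = rep (swap_gens x) ^ t)%g.
Proof.
move=> hM h_surj; have [c13 b12 b23] := lk_gl_braid phi_inj.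
pose Q u v := similar2 (lk_gl phi_inj s1) (lk_gl phi_inj s2) (lk_gl phi_inj s3) (rep u) (rep v).
have repM : {morph rep : x y / (x * y)%g} by move=> x y; apply: gmulfM.
have repV x : rep x^-1%g = (rep x)^-1%g by apply: gmulfV.
have rep_a : rep gen_a = (lk_gl phi_inj s1 * (lk_gl phi_inj s3)^-1)%g by apply: subst_gen.
have rep_b : rep gen_b = (lk_gl phi_inj s2 * rep gen_a * (lk_gl phi_inj s2)^-1)%g.
  by rewrite rep_a; apply: subst_gen.
have : Q (h gen_a) (h gen_b).
  apply: nielsen (generating_image hM h_surj); rewrite /Q.
  - by move=> u v; apply: similar2_swap.
  - by move=> u v; rewrite repV; apply: similar2_inv.
  - by move=> u v; rewrite repM; apply: similar2_mul.
  - by move=> u v g; rewrite !conjgE !repM !repV -!conjgE; apply: similar2_conj.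
  - by left; exists 1%g; rewrite !conjg1 rep_b rep_a.
rewrite /Q /similar2 /similar -rep_a -rep_b.
have swap_a : swap_gens gen_a = gen_b by apply: val_inj.
have swap_b : swap_gens gen_b = gen_a by apply: val_inj.
have morphJ (k : F2 -> F2) t : {morph k : x y / (x * y)%g} ->
  {morph (fun x => rep (k x) ^ t)%g : x y / (x * y)%g}.
  by move=> kM x y; rewrite kM repM conjMg.
case=> -[t [eq_a eq_b]]; exists t; [left | right]; apply: F2_morph_ext; rewrite ?swap_a ?swap_b //.
- by move=> x y; rewrite hM repM.
- exact: (morphJ id).
- by move=> x y; rewrite hM repM.
- by apply: morphJ => x y; apply: gmulfM.
Qed.

(** Pairing the representation with its twist by the exchange of the generators
makes the linear relations stable under all automorphisms. *)
Definition double_rep (x : F2) : 'M[K]_(6, 6 + 6) :=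
  row_mx (GLmx (rep x)) (GLmx (rep (swap_gens x))).

Lemma double_rep_inj : injective double_rep.
Proof. by move=> x y /eq_row_mx[/val_inj/rep_inj]. Qed.

Lemma double_rep_sum n (c : 'I_n -> K) (y : 'I_n -> F2) x :
  double_rep x = \sum_i c i *: double_rep (y i) <->
  GLmx (rep x) = \sum_i c i *: GLmx (rep (y i)) /\
  GLmx (rep (swap_gens x)) = \sum_i c i *: GLmx (rep (swap_gens (y i))).
Proof.
have -> : \sum_i c i *: double_rep (y i)
        = row_mx (\sum_i c i *: GLmx (rep (y i))) (\sum_i c i *: GLmx (rep (swap_gens (y i)))).
  rewrite -[LHS]hsubmxK !linear_sum; congr row_mx; apply: eq_bigr => i _;
    by rewrite linearZ /= ?row_mxKl ?row_mxKr.
by split=> [/eq_row_mx // | [eq1 eq2]]; rewrite /double_rep eq1 eq2.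
Qed.

Lemma rep_rel (h : F2 -> F2) n (c : 'I_n -> K) (y : 'I_n -> F2) x :
    {morph h : x y / (x * y)%g} -> (forall y, exists x, h x = y) ->
    double_rep x = \sum_i c i *: double_rep (y i) ->
  GLmx (rep (h x)) = \sum_i c i *: GLmx (rep (h (y i))).
Proof.
move=> hM h_surj /double_rep_sum[eq1 eq2].
have [t [ht|ht]] := rep_twist hM h_surj; rewrite ht /= ?eq1 ?eq2 mulmx_suml mulmx_sumr;
  by apply: eq_bigr => i _; rewrite ht -scalemxAl -scalemxAr.
Qed.

Lemma swap_gensK x : swap_gens (swap_gens x) = x.
Proof.
move: x; apply: (@F2_morph_ext _ _ id) => //; try exact: val_inj.
by move=> x y; rewrite [swap_gens (x * y)]gmulfM; apply: gmulfM.
Qed.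

Lemma double_rep_rel (h : F2 -> F2) n (c : 'I_n -> K) (y : 'I_n -> F2) x :
    {morph h : x y / (x * y)%g} -> (forall y, exists x, h x = y) ->
    double_rep x = \sum_i c i *: double_rep (y i) ->
  double_rep (h x) = \sum_i c i *: double_rep (h (y i)).
Proof.
move=> hM h_surj rel; apply/double_rep_sum; split; first exact: rep_rel rel.
apply: (rep_rel (h := fun z => swap_gens (h z))) rel.
- by move=> u v; rewrite hM; apply: gmulfM.
- move=> z; have [z' def_z] := h_surj (swap_gens z).
  by exists z'; rewrite def_z swap_gensK.
Qed.

Theorem action_rep (G : groupType) (act : G -> F2 -> F2) :
    (forall x, act 1%g x = x) ->
    (forall g h x, act (g * h)%g x = act g (act h x)) ->
    (forall g, {morph act g : x y / (x * y)%g}) ->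
  exists d (rho : {gmorphism G -> GL K d}), forall g, rho g = 1%g -> forall x, act g x = x.
Proof.
move=> act1 actM act_morph.
have act_surj g y : exists x, act g x = y.
  by exists (act g^-1%g y); rewrite -actM mulgV act1.
have [|d [rho rho_ker]] := @induced_rep K _ F2 G act double_rep act1 actM.
  by move=> g n c y x; apply: double_rep_rel.
by exists d, rho => g /rho_ker fix_g x; apply: double_rep_inj.
Qed.

End Twisted.

(** By block-diagonal sum. *)
Lemma is_linear_by_kernels (G : groupType) (K : fieldType) m n
    (rho : {gmorphism G -> GL K m}) (sigma : {gmorphism G -> GL K n}) :
  [pchar K] =i pred0 -> (forall g, rho g = 1%g -> sigma g = 1%g -> g = 1%g) -> is_linear G.
Proof.
move=> K0 ker1.
have unit_blk g : block_mx (GLmx (rho g)) 0 0 (GLmx (sigma g)) \in unitmx.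
  by rewrite unitmxE det_ublock unitrM -!unitmxE !GLmx_unit.
pose theta0 g : GL K (m + n) := MkGL (unit_blk g).
have theta0M : (theta0 1 = 1)%g * {morph theta0 : g h / (g * h)%g}.
  split=> [|g h]; apply: val_inj => /=; first by rewrite !gmulf1 /= -scalar_mx_block.
  by rewrite mulmx_block !mulmx0 !mul0mx !addr0 !add0r !gmulfM.
pose theta : {gmorphism G -> GL K (m + n)} :=
  HB.pack theta0 (isUMagmaMorphism.Build _ _ theta0 theta0M).
exists K, (m + n)%N, theta; split=> // g h eq_gh.
apply: (@mulIg _ h^-1%g); rewrite mulgV.
have : theta (g * h^-1)%g = 1%g by rewrite gmulfM gmulfV eq_gh mulgV.
move/(congr1 (@GLmx _ _)) => /=; rewrite scalar_mx_block => /eq_block_mx[eq1 _ _ eq2].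
by apply: ker1; apply: val_inj.
Qed.

Definition GL_map (k K : fieldType) (f : {rmorphism k -> K}) m (A : GL k m) : GL K m.
Proof. by exists (map_mx f (GLmx A)); rewrite map_unitmx GLmx_unit. Defined.

Lemma GL_map_morph (k K : fieldType) (f : {rmorphism k -> K}) m :
  (GL_map f (1 : GL k m) = 1)%g * {morph @GL_map k K f m : A B / (A * B)%g}.
Proof. by split=> [|A B]; apply: val_inj => /=; rewrite ?map_mx1 ?map_mxM. Qed.

Lemma GL_map_inj (k K : fieldType) (f : {rmorphism k -> K}) m : injective (@GL_map k K f m).
Proof. by move=> A B /(congr1 (@GLmx _ _)) /= /map_mx_inj/val_inj. Qed.

(** An element of G acting trivially on F2 and trivial in P lies in the center
of F2. *)
Theorem extension_is_linear (P G : groupType)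
    (i : {gmorphism F2 -> G}) (p : {gmorphism G -> P}) :
  is_linear P -> group_extension i p -> is_linear G.
Proof.
move=> [k [m [sigma [k0 sigma_inj]]]] [i_inj ker_p _].
have conj_in g x : exists y, i y == (i x ^ g^-1)%g.
  have /ker_p[y def_y] : p (i x ^ g^-1)%g = 1%g.
    have pi1 : p (i x) = 1%g by apply/ker_p; exists x.
    by rewrite conjgE !gmulfM pi1 mul1g -gmulfM mulVg gmulf1.
  by exists y; apply/eqP.
pose act g x : F2 := xchoose (conj_in g x).
have actE g x : i (act g x) = (i x ^ g^-1)%g by apply/eqP; exact: xchooseP (conj_in g x).
have [] := @action_rep _ _ (int_poly_frac_inj k0) G act.
- by move=> x; apply: i_inj; rewrite actE invg1 conjg1.
- by move=> g h x; apply: i_inj; rewrite !actE invgM conjgM.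
- by move=> g x y; apply: i_inj; rewrite actE !gmulfM !actE conjMg.
move=> d [rho rho_ker].
pose tau0 g : GL (ratfrac k) m := GL_map (constants k) (sigma (p g)).
have tau0M : (tau0 1 = 1)%g * {morph tau0 : g h / (g * h)%g}.
  by split=> [|g h]; rewrite /tau0 ?gmulf1 ?gmulfM GL_map_morph.
pose tau : {gmorphism G -> GL (ratfrac k) m} :=
  HB.pack tau0 (isUMagmaMorphism.Build _ _ tau0 tau0M).
apply: (is_linear_by_kernels (rho := rho) (sigma := tau)); first exact: ratfrac_char0.
move=> g /rho_ker fix_g.
rewrite [tau g]/(GL_map _ _) -(GL_map_morph (constants k) m).1 => /GL_map_inj.
rewrite -(@gmulf1 _ _ sigma) => /sigma_inj/ker_p[n def_g].
suff -> : g = i 1%g by rewrite gmulf1.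
rewrite -def_g; congr (i _); apply: F2_centerless => y.
apply: (mulIg n^-1%g); rewrite mulgK; apply: i_inj.
by rewrite -[RHS](congr1 i (fix_g y)) actE -def_g conjgE invgK !gmulfM gmulfV mulgA.
Qed.

Lemma Zgroup_is_linear : is_linear Zgroup.
Proof.
have unit_pow (n : int) : ((2 : rat) ^ n)%:M \in @unitmx _ 1.
  by rewrite unitmxE det_scalar1 unitfE expfz_neq0.
pose rho0 (n : Zgroup) : GL rat 1 := MkGL (unit_pow (n : int)).
have rho0M : (rho0 1 = 1)%g * {morph rho0 : g h / (g * h)%g}.
  split=> [|g h]; apply: val_inj => //=.
  by rewrite -scalar_mxM -expfzDr.
pose rho : {gmorphism Zgroup -> GL rat 1} :=
  HB.pack rho0 (isUMagmaMorphism.Build _ _ rho0 rho0M).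
exists rat, 1%N, rho; split=> [|m n]; first exact: pchar_num.
move/(congr1 (@GLmx _ _)) => /= /matrixP/(_ 0 0); rewrite !mxE eqxx !mulr1n.
by apply: ieexprIz.
Qed.

Local Close Scope ring_scope.
Local Close Scope group_scope.

Theorem corollary1p1 :
  (forall (P : groupType) (phi : autaction P F2),
      is_linear P -> is_linear (semidirect phi))
  /\
  (forall (P G : groupType)
      (i : {gmorphism F2 -> G}) (p : {gmorphism G -> P}),
      is_linear P -> split_extension i p -> is_linear G)
  /\
  (forall (G : groupType)
      (i : {gmorphism F2 -> G}) (p : {gmorphism G -> Zgroup}),
      group_extension i p -> is_linear G).
Proof.
split; [|split].
- move=> P phi P_linear.
  pose i0 (n : F2) : semidirect phi := SemidirectPair phi n 1%g.
  have i0M : (i0 1 = 1)%g * {morph i0 : m n / (m * n)%g}.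
    by split=> // m n; rewrite /i0 [RHS]/(sd_mul _ _) /sd_mul /= actby1 mul1g.
  pose i : {gmorphism F2 -> semidirect phi} :=
    HB.pack i0 (isUMagmaMorphism.Build _ _ i0 i0M).
  have p0M : (sd_snd (1 : semidirect phi) = 1)%g * {morph @sd_snd _ _ phi : g h / (g * h)%g}.
    by [].
  pose p : {gmorphism semidirect phi -> P} :=
    HB.pack (@sd_snd _ _ phi) (isUMagmaMorphism.Build _ _ (@sd_snd _ _ phi) p0M).
  apply: (extension_is_linear (i := i) (p := p)) P_linear _; split.
  + by move=> m n [].
  + move=> [n h]; split=> [/= ->|[m <-] //].
    by exists n.
  + by move=> h; exists (SemidirectPair phi 1%g h).
- by move=> P G i p P_linear [ext _]; apply: extension_is_linear P_linear ext.
- by move=> G i p; apply: extension_is_linear Zgroup_is_linear.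
Qed.
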